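(* For every real $\beta>0$, $$\int_{0}^{\infty}\frac{e^{-\tau}}{\tau^3}\left(1+\frac{\beta\tau^2}{3}-\sqrt{\beta}\,\tau\coth\left(\sqrt{\beta}\,\tau\right)\right)\mathrm{d}\tau=4\beta\,\zeta^{(1,0)}\left(-1,\frac{1}{2\sqrt{\beta}}\right)+\frac14-\frac{\beta}{3}-\beta\left(\ln 16+2\ln\beta\right)\left(-\frac{1}{12}+\frac{1}{4\sqrt{\beta}}-\frac{1}{8\beta}\right).$$
   Context: $\zeta(z,\nu)$ is the Hurwitz zeta function, i.e. the analytic continuation in $z$ of $\sum_{n=0}^{\infty}(n+\nu)^{-z}$ (convergent for $\mathrm{Re}\,z>1$, $\nu>0$) to $\mathbb{C}\setminus\{1\}$, and $\zeta^{(1,0)}(z,\nu)=\partial\zeta(z,\nu)/\partial z$ is its derivative with respect to the first argument. (The left-hand side is the function $f_{1/2}(\beta)$ giving the one-loop spin-$\frac12$ Heisenberg-Euler Lagrangian $\frac{m^4}{8\pi^2}f_{1/2}(\beta)$ in a constant magnetic background.) *)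

(* Defs.v *)
From Stdlib Require Import Reals ClassicalEpsilon.
From Coquelicot Require Import Coquelicot.

Local Open Scope R_scope.

Definition coth (x : R) : R := cosh x / sinh x.

Definition Cexp (z : C) : C :=
  (exp (fst z) * cos (snd z), exp (fst z) * sin (snd z)).

(* The principal power x^z, meaningful for a positive real base x. *)
Definition Rpower_C (x : R) (z : C) : C := Cexp (z * RtoC (ln x))%C.

(* f is given by a convergent power series on a disc around z0. *)
Definition analytic_at (f : C -> C) (z0 : C) : Prop :=
  exists (a : nat -> C) (r : R), 0 < r /\
    forall z : C, Cmod (z - z0)%C < r ->
      is_pseries (K := C_AbsRing) (V := C_NormedModule) a (z - z0)%C (f z).

Definition is_hurwitz_continuation (nu : R) (f : C -> C) : Prop :=
  (forall z : C, z <> RtoC 1 -> analytic_at f z) /\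
  (forall z : C, 1 < fst z ->
     is_series (K := C_AbsRing) (V := C_NormedModule)
       (fun n : nat => Rpower_C (INR n + nu) (- z)%C) (f z)).

(* For nu > 0 the continuation exists and, by the identity theorem, its values
   on C \ {1} are unique, so the choice only affects the irrelevant value at
   the pole z = 1. *)
Definition hurwitz_zeta (z : C) (nu : R) : C :=
  epsilon (inhabits (fun _ : C => RtoC 0)) (is_hurwitz_continuation nu) z.

(* d is the complex derivative of z |-> hurwitz_zeta z nu at z. *)
Definition is_hurwitz_zeta_deriv (z : C) (nu : R) (d : C) : Prop :=
  is_derive (K := C_AbsRing) (V := C_NormedModule)
    (fun w : C => hurwitz_zeta w nu) z d.

(* Main.v *)
Require Import Defs.
From Stdlib Require Import Reals Lra Lia Factorial ClassicalEpsilon.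
From Coquelicot Require Import Coquelicot.
Local Open Scope R_scope.

(** Put [nu = 1 / (2 sqrt beta)] and [T_m (z, x) = sum_(k < m) B_k binomial(1-z, k) x^(1-z-k)].
    Expanding [(x+1)^(1-z-k)] by the binomial series, the recursion of the Bernoulli numbers
    cancels every term of [(z-1) x^(-z) - T_m (z, x) + T_m (z, x+1)] down to order [x^(-z-m)].
    Hence [T_m (z, nu) + sum_n ((z-1) x_n^(-z) - T_m (z, x_n) + T_m (z, x_n + 1))], with
    [x_n = n + nu], converges locally uniformly for [Re z > 2 - m] and continues
    [(z-1) zeta(z, nu)]; telescoping shows that it does not depend on [m]. No complex
    integration is needed: local uniformity is measured by the norm [sum |a_k| r^k] of power
    series, for which a convergent sum of analytic functions is analytic with termwise
    derivatives. By the identity theorem [hurwitz_zeta] agrees with this continuation near [-1],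
    and [m = 4] gives [zeta'(-1, nu)] as an elementary term plus a series of elementary terms
    [e(n + nu)].

    After [tau = nu u] the integrand becomes [exp (-nu u)] times a kernel [F u], and
    [(1 - exp (-u)) F u = u/6 int_0^1 B_3(s) exp (-u s) ds]. Telescoping in [nu], the integral
    is the sum over [n] of [1/6 int_0^1 B_3(s) / (n + nu + s)^2 ds], which is the same series. *)

(** * Series of complex numbers *)

(** [hurwitz_zeta] is a choice among continuations, so nothing can be said of its derivative before
    a concrete continuation exists, and agreement with it is needed on a whole neighbourhood of
    [-1]. The factor [z - 1] turns the Euler-Maclaurin term [x^(1-z) / (z-1)] into [x^(1-z)], which
    is the term [k = 0] of [T_m]; every term is then entire and the pole returns only in a final
    division. Locally uniform convergence alone would yield termwise derivatives through Cauchy's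
    formula. A bound on [sum |a_k| r^k] controls each coefficient directly, and it survives sums,
    scalings, and products or quotients by linear factors, which is all that the terms require. At
    [-1] the condition [-1 > 2 - m] forces [m >= 4]; as [B_3 = 0], [T_4] still has only three terms.
    On the integral side no improper integrals are exchanged with sums: on a compact interval
    [[a, b]] exactly [N] telescoping steps are made, each with an explicit primitive, and [N] is
    fixed before [a] tends to zero and [b] to infinity. *)

Fixpoint Csum (a : nat -> C) (n : nat) : C :=
  match n with O => RtoC 0 | S n => (Csum a n + a n)%C end.

Fixpoint Rsum (a : nat -> R) (n : nat) : R :=
  match n with O => 0 | S n => Rsum a n + a n end.

Definition Clim (u : nat -> C) (l : C) : Prop :=
  forall eps : R, 0 < eps ->
    exists N : nat, forall n : nat, (N <= n)%nat -> Cmod (u n - l)%C < eps.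

Definition is_Cseries (a : nat -> C) (l : C) : Prop := Clim (Csum a) l.

Lemma Csum_ext (a b : nat -> C) (n : nat) :
  (forall k : nat, (k < n)%nat -> a k = b k) -> Csum a n = Csum b n.
Proof.
  induction n as [|n IH]; intros H; simpl; [easy|].
  rewrite IH, H; auto with arith.
Qed.

Lemma Csum_plus (a b : nat -> C) (n : nat) :
  Csum (fun k => a k + b k)%C n = (Csum a n + Csum b n)%C.
Proof. induction n as [|n IH]; simpl; [|rewrite IH]; ring. Qed.

Lemma Csum_minus (a b : nat -> C) (n : nat) :
  Csum (fun k => a k - b k)%C n = (Csum a n - Csum b n)%C.
Proof. induction n as [|n IH]; simpl; [|rewrite IH]; ring. Qed.

Lemma Csum_scal (c : C) (a : nat -> C) (n : nat) :
  Csum (fun k => c * a k)%C n = (c * Csum a n)%C.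
Proof. induction n as [|n IH]; simpl; [|rewrite IH]; ring. Qed.

Lemma Csum_zero (n : nat) : Csum (fun _ => RtoC 0) n = RtoC 0.
Proof. induction n as [|n IH]; simpl; [|rewrite IH]; ring. Qed.

Lemma Csum_add (a : nat -> C) (n m : nat) :
  Csum a (n + m) = (Csum a n + Csum (fun k => a (n + k)%nat) m)%C.
Proof.
  induction m as [|m IH]; simpl; [rewrite Nat.add_0_r; ring|].
  rewrite Nat.add_succ_r; simpl; rewrite IH; ring.
Qed.

Lemma Rsum_ext (a b : nat -> R) (n : nat) :
  (forall k : nat, (k < n)%nat -> a k = b k) -> Rsum a n = Rsum b n.
Proof.
  induction n as [|n IH]; intros H; simpl; [easy|].
  rewrite IH, H; auto with arith.
Qed.

Lemma Rsum_le (a b : nat -> R) (n : nat) :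
  (forall k : nat, (k < n)%nat -> a k <= b k) -> Rsum a n <= Rsum b n.
Proof.
  induction n as [|n IH]; intros H; simpl; [lra|].
  apply Rplus_le_compat; auto with arith.
Qed.

Lemma Rsum_plus (a b : nat -> R) (n : nat) :
  Rsum (fun k => a k + b k) n = Rsum a n + Rsum b n.
Proof. induction n as [|n IH]; simpl; [|rewrite IH]; ring. Qed.

Lemma Rsum_scal (c : R) (a : nat -> R) (n : nat) :
  Rsum (fun k => c * a k) n = c * Rsum a n.
Proof. induction n as [|n IH]; simpl; [|rewrite IH]; ring. Qed.

Lemma Rsum_zero (n : nat) : Rsum (fun _ => 0) n = 0.
Proof. induction n as [|n IH]; simpl; [|rewrite IH]; ring. Qed.

Lemma Rsum_swap (a : nat -> nat -> R) (n m : nat) :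
  Rsum (fun i => Rsum (fun j => a i j) m) n = Rsum (fun j => Rsum (fun i => a i j) n) m.
Proof.
  induction n as [|n IH]; simpl; [now rewrite Rsum_zero|].
  now rewrite IH, Rsum_plus.
Qed.

Lemma Rsum_S (a : nat -> R) (n : nat) : Rsum a (S n) = a O + Rsum (fun k => a (S k)) n.
Proof.
  induction n as [|n IH]; [simpl; ring|].
  change (Rsum a (S (S n))) with (Rsum a (S n) + a (S n)).
  rewrite IH; simpl; ring.
Qed.

Lemma Rsum_nonneg (a : nat -> R) (n : nat) : (forall k : nat, 0 <= a k) -> 0 <= Rsum a n.
Proof.
  intros H; induction n as [|n IH]; simpl; [lra|].
  specialize (H n); lra.
Qed.

Lemma Rsum_incr (a : nat -> R) (n m : nat) :
  (forall k : nat, 0 <= a k) -> (n <= m)%nat -> Rsum a n <= Rsum a m.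
Proof.
  intros H Hnm; induction Hnm as [|m Hnm IH]; simpl; [lra|].
  specialize (H m); lra.
Qed.

Lemma Rsum_term (a : nat -> R) (n : nat) (M : R) :
  (forall k : nat, 0 <= a k) -> (forall K : nat, Rsum a K <= M) -> a n <= M.
Proof.
  intros H HM; generalize (HM (S n)) (Rsum_nonneg a n H); simpl; lra.
Qed.

Lemma Cmod_Csum_le (a : nat -> C) (n : nat) : Cmod (Csum a n) <= Rsum (fun k => Cmod (a k)) n.
Proof.
  induction n as [|n IH]; simpl; [rewrite Cmod_0; lra|].
  eapply Rle_trans; [apply Cmod_triangle|]; lra.
Qed.

Lemma Cmod_Csum_diff_le (a : nat -> C) (M : nat -> R) (n m : nat) :
  (forall k : nat, Cmod (a k) <= M k) -> (n <= m)%nat ->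
  Cmod (Csum a m - Csum a n)%C <= Rsum M m - Rsum M n.
Proof.
  intros H Hnm; induction Hnm as [|m Hnm IH]; simpl.
  - replace (Csum a n - Csum a n)%C with (RtoC 0) by ring; rewrite Cmod_0; lra.
  - replace (Csum a m + a m - Csum a n)%C with ((Csum a m - Csum a n) + a m)%C by ring.
    eapply Rle_trans; [apply Cmod_triangle|]; specialize (H m); lra.
Qed.

Lemma Cmod_minus_sym (x y : C) : Cmod (x - y)%C = Cmod (y - x)%C.
Proof. rewrite <- Cmod_opp; f_equal; ring. Qed.

Lemma Clim_const (c : C) : Clim (fun _ => c) c.
Proof.
  intros e He; exists O; intros n _.
  replace (c - c)%C with (RtoC 0) by ring; now rewrite Cmod_0.
Qed.

Lemma Clim_ext (u v : nat -> C) (l : C) :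
  (forall n : nat, u n = v n) -> Clim u l -> Clim v l.
Proof. intros H Hu e He; destruct (Hu e He) as [N HN]; exists N; intros n Hn; rewrite <- H; auto. Qed.

Lemma Clim_plus (u v : nat -> C) (l m : C) :
  Clim u l -> Clim v m -> Clim (fun n => u n + v n)%C (l + m)%C.
Proof.
  intros Hu Hv e He.
  destruct (Hu (e / 2)) as [N HN]; [lra|]; destruct (Hv (e / 2)) as [N' HN']; [lra|].
  exists (N + N')%nat; intros n Hn.
  replace (u n + v n - (l + m))%C with ((u n - l) + (v n - m))%C by ring.
  eapply Rle_lt_trans; [apply Cmod_triangle|].
  specialize (HN n ltac:(lia)); specialize (HN' n ltac:(lia)); lra.
Qed.

Lemma Clim_le (u v : nat -> C) (l m : C) (c : R) :
  0 <= c -> Clim u l -> (forall n : nat, Cmod (v n - m)%C <= c * Cmod (u n - l)%C) ->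
  Clim v m.
Proof.
  intros Hc Hu H e He.
  destruct (Hu (e / (c + 1))) as [N HN]; [apply Rdiv_lt_0_compat; lra|].
  exists N; intros n Hn; specialize (HN n Hn); specialize (H n).
  apply Rle_lt_trans with (1 := H).
  apply Rle_lt_trans with (c * (e / (c + 1))); [apply Rmult_le_compat_l; lra|].
  apply Rlt_le_trans with ((c + 1) * (e / (c + 1))); [|right; field; lra].
  apply Rmult_lt_compat_r; [apply Rdiv_lt_0_compat; lra|lra].
Qed.

Lemma Clim_scal (c : C) (u : nat -> C) (l : C) :
  Clim u l -> Clim (fun n => c * u n)%C (c * l)%C.
Proof.
  intros Hu; apply (Clim_le u _ l _ (Cmod c)); [apply Cmod_ge_0|easy|].
  intros n; replace (c * u n - c * l)%C with (c * (u n - l))%C by ring.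
  rewrite Cmod_mult; lra.
Qed.

Lemma Clim_minus (u v : nat -> C) (l m : C) :
  Clim u l -> Clim v m -> Clim (fun n => u n - v n)%C (l - m)%C.
Proof.
  intros Hu Hv; replace (l - m)%C with (l + RtoC (-1) * m)%C by ring.
  eapply Clim_ext; [|apply (Clim_plus _ _ _ _ Hu (Clim_scal (RtoC (-1)) _ _ Hv))].
  intros n; simpl; ring.
Qed.

Lemma Clim_norm_le (u : nat -> C) (l : C) (M : R) :
  Clim u l -> (exists N : nat, forall n : nat, (N <= n)%nat -> Cmod (u n) <= M) -> Cmod l <= M.
Proof.
  intros Hu [N H]; apply Rnot_lt_le; intros Hl.
  destruct (Hu (Cmod l - M)) as [N' HN']; [lra|].
  specialize (HN' (N + N')%nat ltac:(lia)); specialize (H (N + N')%nat ltac:(lia)).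
  generalize (Cmod_triangle (u (N + N')%nat) (l - u (N + N')%nat)%C).
  replace (u (N + N')%nat + (l - u (N + N')%nat))%C with l by ring.
  rewrite (Cmod_minus_sym l); lra.
Qed.

Lemma Clim_unique (u : nat -> C) (l m : C) : Clim u l -> Clim u m -> l = m.
Proof.
  intros Hl Hm; apply Ceq_minus, Cmod_eq_0, Rle_antisym; [|apply Cmod_ge_0].
  apply (Clim_norm_le (fun n => u n - u n)%C); [now apply Clim_minus|].
  exists O; intros n _; replace (u n - u n)%C with (RtoC 0) by ring.
  rewrite Cmod_0; lra.
Qed.

Lemma Clim_incr (u : nat -> C) (l : C) (p : nat) :
  Clim (fun n => u (p + n)%nat) l <-> Clim u l.
Proof.
  split; intros H e He; destruct (H e He) as [N HN].
  - exists (p + N)%nat; intros n Hn; replace n with (p + (n - p))%nat by lia; apply HN; lia.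
  - exists N; intros n Hn; apply HN; lia.
Qed.

Lemma is_Cseries_ext (a b : nat -> C) (l : C) :
  (forall n : nat, a n = b n) -> is_Cseries a l -> is_Cseries b l.
Proof. intros H; apply Clim_ext; intros n; apply Csum_ext; auto. Qed.

Lemma is_Cseries_plus (a b : nat -> C) (l m : C) :
  is_Cseries a l -> is_Cseries b m -> is_Cseries (fun n => a n + b n)%C (l + m)%C.
Proof.
  intros Ha Hb; eapply Clim_ext; [|apply (Clim_plus _ _ _ _ Ha Hb)].
  intros n; simpl; now rewrite Csum_plus.
Qed.

Lemma is_Cseries_minus (a b : nat -> C) (l m : C) :
  is_Cseries a l -> is_Cseries b m -> is_Cseries (fun n => a n - b n)%C (l - m)%C.
Proof.
  intros Ha Hb; eapply Clim_ext; [|apply (Clim_minus _ _ _ _ Ha Hb)].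
  intros n; simpl; now rewrite Csum_minus.
Qed.

Lemma is_Cseries_scal (c : C) (a : nat -> C) (l : C) :
  is_Cseries a l -> is_Cseries (fun n => c * a n)%C (c * l)%C.
Proof.
  intros Ha; eapply Clim_ext; [|apply (Clim_scal c _ _ Ha)].
  intros n; simpl; now rewrite Csum_scal.
Qed.

Lemma is_Cseries_incr (a : nat -> C) (l : C) (p : nat) :
  is_Cseries (fun n => a (p + n)%nat) l <-> is_Cseries a (Csum a p + l)%C.
Proof.
  unfold is_Cseries; rewrite <- (Clim_incr (Csum a) _ p); split; intros H.
  - eapply Clim_ext; [|apply (Clim_plus _ _ _ _ (Clim_const (Csum a p)) H)].
    intros n; simpl; now rewrite Csum_add.
  - replace l with (Csum a p + l - Csum a p)%C by ring.
    eapply Clim_ext; [|apply (Clim_minus _ _ _ _ H (Clim_const (Csum a p)))].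
    intros n; simpl; rewrite Csum_add; ring.
Qed.

Lemma is_Cseries_finite (a : nat -> C) (p : nat) :
  (forall k : nat, (p <= k)%nat -> a k = RtoC 0) -> is_Cseries a (Csum a p).
Proof.
  intros H; replace (Csum a p) with (Csum a p + RtoC 0)%C by ring.
  apply is_Cseries_incr; apply is_Cseries_ext with (fun _ => RtoC 0).
  - intros n; now rewrite H by lia.
  - eapply Clim_ext; [|apply Clim_const]; intros n; simpl; now rewrite Csum_zero.
Qed.

Lemma is_Cseries_finite_eq (a : nat -> C) (p : nat) (l : C) :
  (forall k : nat, (p <= k)%nat -> a k = RtoC 0) -> Csum a p = l -> is_Cseries a l.
Proof. intros H <-; now apply is_Cseries_finite. Qed.

(** * Dominated series *)

(** Passing from an arbitrary bound [S] to the least one makes [L - Rsum M N] a remainder bound that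
    tends to zero. *)
Lemma Rsum_lub (M : nat -> R) (S : R) :
  (forall n : nat, 0 <= M n) -> (forall n : nat, Rsum M n <= S) ->
  exists L : R, L <= S /\ (forall n : nat, Rsum M n <= L) /\
    forall eps : R, 0 < eps -> exists N : nat, forall n : nat, (N <= n)%nat -> L - eps < Rsum M n.
Proof.
  intros HM HS.
  destruct (completeness (fun x => exists n : nat, x = Rsum M n)) as [L [HL1 HL2]].
  - exists S; intros x [n ->]; apply HS.
  - exists (Rsum M O); now exists O.
  - exists L; split; [apply HL2; intros x [n ->]; apply HS|].
    split; [intros n; apply HL1; now exists n|].
    intros e He; apply Classical_Prop.NNPP; intros Hn.
    assert (L <= L - e); [|lra].
    apply HL2; intros x [n ->]; apply Rnot_lt_le; intros Hlt; apply Hn.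
    exists n; intros m Hm; apply Rlt_le_trans with (1 := Hlt); now apply Rsum_incr.
Qed.

Lemma is_Cseries_dominated (a : nat -> C) (M : nat -> R) (S : R) :
  (forall n : nat, Cmod (a n) <= M n) -> (forall n : nat, Rsum M n <= S) ->
  exists l : C, is_Cseries a l /\ Cmod l <= S.
Proof.
  intros Ha HS.
  assert (HM : forall n, 0 <= M n)
    by (intros n; apply Rle_trans with (2 := Ha n), Cmod_ge_0).
  destruct (Rsum_lub M S HM HS) as [L [HLS [HL1 HL2]]].
  assert (HC : forall e, 0 < e -> exists N : nat, forall n m, (N <= n)%nat -> (N <= m)%nat ->
    Cmod (Csum a n - Csum a m)%C < e).
  { intros e He; destruct (HL2 e He) as [N HN]; exists N.
    assert (Hlt : forall n m, (N <= n)%nat -> (n <= m)%nat -> Cmod (Csum a m - Csum a n)%C < e).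
    { intros n m Hn Hnm; eapply Rle_lt_trans; [apply (Cmod_Csum_diff_le a M n m Ha Hnm)|].
      generalize (HN n Hn) (HL1 m); lra. }
    intros n m Hn Hm; destruct (Nat.le_ge_cases n m); [rewrite Cmod_minus_sym|]; auto. }
  destruct (Rcomplete.R_complete (fun n => fst (Csum a n))) as [x Hx].
  { intros e He; destruct (HC e He) as [N HN]; exists N; intros n m Hn Hm.
    eapply Rle_lt_trans; [|apply (HN n m Hn Hm)]; unfold Rdist.
    apply (re_le_Cmod (Csum a n - Csum a m)%C). }
  destruct (Rcomplete.R_complete (fun n => snd (Csum a n))) as [y Hy].
  { intros e He; destruct (HC e He) as [N HN]; exists N; intros n m Hn Hm.
    eapply Rle_lt_trans; [|apply (HN n m Hn Hm)]; unfold Rdist.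
    eapply Rle_trans; [|apply (Rmax_Cmod (Csum a n - Csum a m)%C)]; apply Rmax_r. }
  assert (Hl : is_Cseries a (x, y)).
  { intros e He; destruct (Hx (e / 2)) as [N HN]; [lra|].
    destruct (Hy (e / 2)) as [N' HN']; [lra|].
    exists (N + N')%nat; intros n Hn.
    specialize (HN n ltac:(lia)); specialize (HN' n ltac:(lia)); unfold Rdist in *.
    eapply Rle_lt_trans; [apply Cmod_2Rmax|]; simpl.
    assert (Hs : 0 <= sqrt 2 < 2).
    { split; [apply sqrt_pos|].
      rewrite <- (sqrt_square 2) at 2 by lra; apply sqrt_lt_1; lra. }
    assert (Hm : Rmax (Rabs (fst (Csum a n) + - x)) (Rabs (snd (Csum a n) + - y)) < e / 2)
      by (apply Rmax_lub_lt; assumption).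
    generalize (Rmax_l (Rabs (fst (Csum a n) + - x)) (Rabs (snd (Csum a n) + - y)))
      (Rabs_pos (fst (Csum a n) + - x)); intros; nra. }
  exists (x, y); split; [easy|].
  apply (Clim_norm_le _ _ _ Hl); exists O; intros n _.
  eapply Rle_trans; [apply Cmod_Csum_le|].
  eapply Rle_trans; [apply (Rsum_le _ M); auto|apply HS].
Qed.

Lemma is_Cseries_tail_le (a : nat -> C) (M : nat -> R) (L : R) (l : C) (N : nat) :
  (forall n : nat, Cmod (a n) <= M n) -> (forall n : nat, Rsum M n <= L) -> is_Cseries a l ->
  Cmod (l - Csum a N)%C <= L - Rsum M N.
Proof.
  intros Ha HL Hl.
  apply (Clim_norm_le (fun n => Csum a n - Csum a N)%C).
  - apply Clim_minus; [apply Hl|apply Clim_const].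
  - exists N; intros n Hn; eapply Rle_trans; [apply (Cmod_Csum_diff_le a M N n Ha Hn)|].
    specialize (HL n); lra.
Qed.

Lemma is_Cseries_norm_le (a : nat -> C) (M : nat -> R) (L : R) (l : C) :
  (forall n : nat, Cmod (a n) <= M n) -> (forall n : nat, Rsum M n <= L) -> is_Cseries a l ->
  Cmod l <= L.
Proof.
  intros Ha HL Hl; generalize (is_Cseries_tail_le a M L l O Ha HL Hl); simpl.
  replace (l - RtoC 0)%C with l by ring; lra.
Qed.

Lemma Clim_Csum_zero (c : nat -> nat -> C) (N : nat) :
  (forall n : nat, Clim (fun K => c K n) (RtoC 0)) ->
  Clim (fun K => Csum (c K) N) (RtoC 0).
Proof.
  intros H; induction N as [|N IH]; simpl; [apply Clim_const|].
  replace (RtoC 0) with (RtoC 0 + RtoC 0)%C by ring; now apply Clim_plus.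
Qed.

(* Tannery's theorem. *)
Lemma is_Cseries_dominated_limit (c : nat -> nat -> C) (M : nat -> R) (S : R) (l : nat -> C) :
  (forall K n : nat, Cmod (c K n) <= M n) -> (forall n : nat, Rsum M n <= S) ->
  (forall n : nat, Clim (fun K => c K n) (RtoC 0)) ->
  (forall K : nat, is_Cseries (c K) (l K)) -> Clim l (RtoC 0).
Proof.
  intros Hc HS H0 Hl e He.
  assert (HM : forall n, 0 <= M n)
    by (intros n; apply Rle_trans with (2 := Hc O n), Cmod_ge_0).
  destruct (Rsum_lub M S HM HS) as [L [_ [HL1 HL2]]].
  destruct (HL2 (e / 2)) as [N HN]; [lra|].
  destruct (Clim_Csum_zero c N H0 (e / 2)) as [K0 HK0]; [lra|].
  exists K0; intros K HK.
  replace (l K - RtoC 0)%C with ((l K - Csum (c K) N) + (Csum (c K) N - RtoC 0))%C by ring.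
  eapply Rle_lt_trans; [apply Cmod_triangle|].
  generalize (is_Cseries_tail_le (c K) M L (l K) N (Hc K) HL1 (Hl K)) (HN N ltac:(lia)) (HK0 K HK); lra.
Qed.

Lemma sum_n_Csum (a : nat -> C) (n : nat) :
  sum_n (G := AbelianGroup.AbelianMonoid (NormedModule.AbelianGroup C_AbsRing C_NormedModule)) a n = Csum a (S n).
Proof.
  induction n as [|n IH].
  - rewrite sum_O; simpl; ring.
  - rewrite sum_Sn, IH; reflexivity.
Qed.

Lemma is_Cseries_is_series (a : nat -> C) (l : C) :
  is_Cseries a l <-> is_series (K := C_AbsRing) (V := C_NormedModule) a l.
Proof.
  split; intros H.
  - refine (proj2 (@filterlim_locally_ball_norm C_AbsRing nat C_NormedModule eventually _ _ l) _).
    intros e; destruct (H e (cond_pos e)) as [N HN]; exists N; intros n Hn.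
    rewrite sum_n_Csum; apply (HN (S n)); lia.
  - intros e He.
    destruct (proj1 (@filterlim_locally_ball_norm C_AbsRing nat C_NormedModule eventually _ _ l) H
      (mkposreal e He)) as [N HN].
    exists (S N); intros n Hn.
    destruct n as [|n]; [lia|]; specialize (HN n ltac:(lia)).
    rewrite sum_n_Csum in HN; exact HN.
Qed.

(** * Functions with an absolutely convergent power series on a disc *)

(* [f] has a power series at [z0] with linear coefficient [d] and norm
   [sum |a_k| r^k] at most [M], representing it on the closed disc of radius [r]. *)
Definition disc_analytic (z0 : C) (r : R) (f : C -> C) (d : C) (M : R) : Prop :=
  exists a : nat -> C,
    a 1%nat = d /\
    (forall K : nat, Rsum (fun k => Cmod (a k) * r ^ k) K <= M) /\
    (forall z : C, Cmod (z - z0)%C <= r -> is_Cseries (fun k => a k * (z - z0) ^ k)%C (f z)).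

Lemma Cmod_term_le (a w : C) (r : R) (k : nat) :
  Cmod w <= r -> Cmod (a * w ^ k)%C <= Cmod a * r ^ k.
Proof.
  intros H; rewrite Cmod_mult, Cmod_pow.
  apply Rmult_le_compat_l; [apply Cmod_ge_0|].
  apply pow_incr; split; [apply Cmod_ge_0|easy].
Qed.

Lemma Cmod_coef_ge_0 (a : C) (r : R) (k : nat) : 0 <= r -> 0 <= Cmod a * r ^ k.
Proof. intros; apply Rmult_le_pos; [apply Cmod_ge_0|now apply pow_le]. Qed.

Lemma Cmod_center (z0 : C) (r : R) : 0 <= r -> Cmod (z0 - z0)%C <= r.
Proof. intros; replace (z0 - z0)%C with (RtoC 0) by ring; now rewrite Cmod_0. Qed.

Lemma is_Cseries_at_zero (a : nat -> C) (l : C) :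
  is_Cseries (fun k => a k * (RtoC 0) ^ k)%C l -> l = a O.
Proof.
  intros H; eapply Clim_unique; [exact H|].
  replace (a O) with (Csum (fun k => a k * RtoC 0 ^ k)%C 1) by (simpl; ring).
  apply (is_Cseries_finite _ 1); intros k Hk; destruct k as [|k]; [lia|].
  rewrite Cpow_S; ring.
Qed.

Lemma disc_analytic_norm_ge_0 (z0 : C) (r : R) (f : C -> C) (d : C) (M : R) : disc_analytic z0 r f d M -> 0 <= M.
Proof. intros (a & _ & HM & _); exact (HM O). Qed.

Lemma disc_analytic_bound (z0 : C) (r : R) (f : C -> C) (d : C) (M : R) (z : C) :
  disc_analytic z0 r f d M -> Cmod (z - z0)%C <= r -> Cmod (f z) <= M.
Proof.
  intros (a & _ & HM & Ha) Hz.
  apply (is_Cseries_norm_le _ (fun k => Cmod (a k) * r ^ k) _ _ (fun k => Cmod_term_le _ _ _ k Hz) HM).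
  now apply Ha.
Qed.

Lemma disc_analytic_ext (z0 : C) (r : R) (f g : C -> C) (d d' : C) (M M' : R) :
  (forall z : C, Cmod (z - z0)%C <= r -> f z = g z) -> d = d' -> M <= M' ->
  disc_analytic z0 r f d M -> disc_analytic z0 r g d' M'.
Proof.
  intros H <- HM (a & H1 & H2 & H3); exists a; repeat split; auto.
  - intros K; eapply Rle_trans; [apply H2|easy].
  - intros z Hz; rewrite <- H; auto.
Qed.

Lemma disc_analytic_const (z0 : C) (r : R) (c : C) : 0 <= r -> disc_analytic z0 r (fun _ => c) (RtoC 0) (Cmod c).
Proof.
  intros Hr; exists (fun k => match k with O => c | S _ => RtoC 0 end); repeat split.
  - intros K; destruct K as [|K]; [apply Cmod_ge_0|].
    rewrite Rsum_S, (Rsum_ext _ (fun _ => 0)), Rsum_zero; [simpl; lra|].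
    intros k _; simpl; rewrite Cmod_0; ring.
  - intros z _.
    apply (is_Cseries_finite_eq _ 1); [|simpl; ring].
    intros k Hk; destruct k as [|k]; [lia|ring].
Qed.

Lemma disc_analytic_scal (z0 : C) (r : R) (c : C) (f : C -> C) (d : C) (M : R) :
  0 <= r -> disc_analytic z0 r f d M -> disc_analytic z0 r (fun z => c * f z)%C (c * d)%C (Cmod c * M).
Proof.
  intros Hr (a & H1 & H2 & H3); exists (fun k => c * a k)%C; repeat split.
  - now rewrite H1.
  - intros K; rewrite (Rsum_ext _ (fun k => Cmod c * (Cmod (a k) * r ^ k))).
    + rewrite Rsum_scal; apply Rmult_le_compat_l; [apply Cmod_ge_0|easy].
    + intros k _; rewrite Cmod_mult; ring.
  - intros z Hz; eapply is_Cseries_ext; [|apply (is_Cseries_scal c _ _ (H3 z Hz))].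
    intros n; simpl; ring.
Qed.

Lemma disc_analytic_plus (z0 : C) (r : R) (f g : C -> C) (d e : C) (M N : R) :
  0 <= r -> disc_analytic z0 r f d M -> disc_analytic z0 r g e N ->
  disc_analytic z0 r (fun z => f z + g z)%C (d + e)%C (M + N).
Proof.
  intros Hr (a & H1 & H2 & H3) (b & G1 & G2 & G3).
  exists (fun k => a k + b k)%C; repeat split.
  - now rewrite H1, G1.
  - intros K; eapply Rle_trans.
    + apply (Rsum_le _ (fun k => Cmod (a k) * r ^ k + Cmod (b k) * r ^ k)).
      intros k _; rewrite <- Rmult_plus_distr_r.
      apply Rmult_le_compat_r; [now apply pow_le|apply Cmod_triangle].
    + rewrite Rsum_plus; apply Rplus_le_compat; auto.
  - intros z Hz; eapply is_Cseries_ext; [|apply (is_Cseries_plus _ _ _ _ (H3 z Hz) (G3 z Hz))].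
    intros n; simpl; ring.
Qed.

Definition mul_lin_coef (c : C) (a : nat -> C) (k : nat) : C :=
  match k with O => (c * a O)%C | S j => (c * a (S j) + a j)%C end.

Lemma is_Cseries_mul_lin (c w : C) (a : nat -> C) (l : C) :
  is_Cseries (fun k => a k * w ^ k)%C l ->
  is_Cseries (fun k => mul_lin_coef c a k * w ^ k)%C ((c + w) * l)%C.
Proof.
  intros H; replace ((c + w) * l)%C with (c * l + w * l)%C by ring.
  apply is_Cseries_ext with
    (fun k => c * (a k * w ^ k) + match k with O => RtoC 0 | S j => w * (a j * w ^ j) end)%C.
  - intros [|k]; simpl; ring.
  - apply is_Cseries_plus; [now apply is_Cseries_scal|].
    replace (w * l)%C with
      (Csum (fun k => match k with O => RtoC 0 | S j => w * (a j * w ^ j) end)%C 1 + w * l)%C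
      by (simpl; ring).
    apply is_Cseries_incr; simpl; now apply is_Cseries_scal.
Qed.

Lemma disc_analytic_mul_lin (z0 : C) (r : R) (c : C) (f : C -> C) (d : C) (M : R) :
  0 <= r -> disc_analytic z0 r f d M ->
  disc_analytic z0 r (fun z => (z - c) * f z)%C ((z0 - c) * d + f z0)%C ((Cmod (z0 - c)%C + r) * M).
Proof.
  intros Hr (a & H1 & H2 & H3).
  exists (mul_lin_coef (z0 - c)%C a); repeat split.
  - simpl; rewrite H1; f_equal; symmetry; apply is_Cseries_at_zero.
    generalize (H3 z0 (Cmod_center z0 r Hr)).
    now replace (z0 - z0)%C with (RtoC 0) by ring.
  - intros K; set (q := Cmod (z0 - c)%C).
    assert (Hq : 0 <= q) by apply Cmod_ge_0.
    assert (HM : 0 <= M) by exact (H2 O).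
    apply Rle_trans with
      (Rsum (fun k => q * (Cmod (a k) * r ^ k)
         + match k with O => 0 | S j => r * (Cmod (a j) * r ^ j) end) K).
    + apply Rsum_le; intros [|k] _; simpl; fold q.
      * rewrite Cmod_mult; fold q; right; ring.
      * eapply Rle_trans;
          [apply Rmult_le_compat_r; [apply (pow_le r (S k) Hr)|apply Cmod_triangle]|].
        rewrite Cmod_mult; fold q; simpl; right; ring.
    + rewrite Rsum_plus, Rsum_scal, Rmult_plus_distr_r.
      apply Rplus_le_compat; [now apply Rmult_le_compat_l|].
      destruct K as [|K]; [simpl; now apply Rmult_le_pos|].
      rewrite Rsum_S, Rsum_scal, Rplus_0_l; now apply Rmult_le_compat_l.
  - intros z Hz; replace (z - c)%C with ((z0 - c) + (z - z0))%C by ring.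
    apply is_Cseries_mul_lin; auto.
Qed.

(** The recursion solves [mul_lin_coef c b = a] for [b]: it is the division of a power series by
    [c + w]. *)
Fixpoint div_lin_coef (c : C) (a : nat -> C) (k : nat) : C :=
  match k with O => (a O / c)%C | S j => ((a (S j) - div_lin_coef c a j) / c)%C end.

(** The recursion [c0 b_k = a_k - b_(k-1)] bounds the weighted sums [s] of the quotient by
    [|c0| s_(K+1) <= M + r s_K], hence [(|c0| - r) s <= M]. The sum [G] of the quotient series is
    then identified by multiplying back and comparing limits. *)
Lemma disc_analytic_div_lin (z0 : C) (r : R) (c : C) (f : C -> C) (d : C) (M : R) :
  0 <= r < Cmod (z0 - c)%C -> disc_analytic z0 r f d M ->
  disc_analytic z0 r (fun z => f z / (z - c))%C ((d - f z0 / (z0 - c)) / (z0 - c))%C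
    (M / (Cmod (z0 - c)%C - r)).
Proof.
  intros [Hr Hrc] (a & H1 & H2 & H3); set (c0 := (z0 - c)%C) in *.
  assert (Hc0 : c0 <> RtoC 0) by (intros E; rewrite E, Cmod_0 in Hrc; lra).
  assert (Hf0 : f z0 = a O).
  { apply is_Cseries_at_zero; generalize (H3 z0 (Cmod_center z0 r Hr)).
    now replace (z0 - z0)%C with (RtoC 0) by ring. }
  set (b := div_lin_coef c0 a).
  assert (HB : forall K, Rsum (fun k => Cmod (b k) * r ^ k) K <= M / (Cmod c0 - r)).
  { set (s := Rsum (fun k => Cmod (b k) * r ^ k)).
    assert (HM : 0 <= M) by exact (H2 O).
    assert (Hs0 : forall K, 0 <= s K)
      by (intros K; apply Rsum_nonneg; intros; now apply Cmod_coef_ge_0).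
    assert (Hs : forall K, Cmod c0 * s (S K) <= Rsum (fun k => Cmod (a k) * r ^ k) (S K) + r * s K).
    { induction K as [|K IH].
      - unfold s; simpl; assert (E : Cmod (b O) = Cmod (a O) / Cmod c0) by now apply Cmod_div.
        rewrite E; right; field; lra.
      - change (s (S (S K))) with (s (S K) + Cmod (b (S K)) * r ^ S K).
        change (s (S K)) with (s K + Cmod (b K) * r ^ K) at 2.
        change (Rsum (fun k => Cmod (a k) * r ^ k) (S (S K))) with
          (Rsum (fun k => Cmod (a k) * r ^ k) (S K) + Cmod (a (S K)) * r ^ S K).
        assert (Hb : Cmod c0 * Cmod (b (S K)) <= Cmod (a (S K)) + Cmod (b K)).
        { rewrite <- Cmod_mult; replace (c0 * b (S K))%C with (a (S K) - b K)%C.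
          - eapply Rle_trans; [apply Cmod_triangle|]; rewrite Cmod_opp; lra.
          - unfold b; simpl; field; easy. }
        assert (Hp : 0 <= r ^ S K) by now apply pow_le.
        generalize (Rmult_le_compat_r _ _ _ Hp Hb); simpl in *; lra. }
    intros K; fold (s K).
    assert (s K <= s (S K)) by (unfold s; simpl; generalize (Cmod_coef_ge_0 (b K) r K Hr); lra).
    apply Rmult_le_reg_r with (Cmod c0 - r); [lra|].
    replace (M / (Cmod c0 - r) * (Cmod c0 - r)) with M by (field; lra).
    generalize (Hs K) (H2 (S K)) (Hs0 K); simpl; nra. }
  exists b; repeat split; [|easy|].
  - rewrite <- H1, Hf0; reflexivity.
  - intros z Hz.
    destruct (is_Cseries_dominated (fun k => b k * (z - z0) ^ k)%C _ _
      (fun k => Cmod_term_le (b k) (z - z0)%C r k Hz) HB) as [G [HG _]].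
    assert (Hzc : (z - c)%C <> RtoC 0).
    { intros E; assert (E' : (z - z0)%C = (- c0)%C).
      { unfold c0; replace (z - z0)%C with ((z - c) - (z0 - c))%C by ring; rewrite E; ring. }
      rewrite E', Cmod_opp in Hz; lra. }
    replace (f z / (z - c))%C with G; [easy|].
    assert (E : f z = ((c0 + (z - z0)) * G)%C).
    { eapply Clim_unique; [apply (H3 z Hz)|].
      generalize (is_Cseries_mul_lin c0 _ _ _ HG); apply is_Cseries_ext.
      intros [|k]; simpl; unfold b; simpl; field; easy. }
    rewrite E; replace (c0 + (z - z0))%C with (z - c)%C by (unfold c0; ring); now field.
Qed.

Lemma is_Cseries_Csum (b : nat -> nat -> C) (beta : nat -> C) (K : nat) :
  (forall k : nat, is_Cseries (fun n => b n k) (beta k)) ->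
  is_Cseries (fun n => Csum (b n) K) (Csum beta K).
Proof.
  intros H; induction K as [|K IH]; simpl.
  - apply (is_Cseries_finite (fun _ => RtoC 0) 0); easy.
  - now apply is_Cseries_plus.
Qed.

(** Semicontinuity of the weighted norm under coefficientwise limits; only finitely many
    coefficients occur, so the errors add up to any prescribed [e]. *)
Lemma Rsum_Cmod_lim_le (u : nat -> nat -> C) (alpha : nat -> C) (c : nat -> R) (S : R) (K : nat) :
  (forall k : nat, 0 <= c k) -> (forall k : nat, Clim (u k) (alpha k)) ->
  (forall N : nat, Rsum (fun k => Cmod (u k N) * c k) K <= S) ->
  Rsum (fun k => Cmod (alpha k) * c k) K <= S.
Proof.
  intros Hc Hu HS.
  assert (Heps : forall e, 0 < e -> exists N0 : nat, forall N, (N0 <= N)%nat ->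
    Rsum (fun k => Cmod (alpha k) * c k) K <= Rsum (fun k => Cmod (u k N) * c k) K + e).
  { clear HS; induction K as [|K IH]; intros e He; [exists O; intros; simpl; lra|].
    destruct (IH (e / 2)) as [N1 HN1]; [lra|].
    destruct (Hu K (e / 2 / (c K + 1))) as [N2 HN2].
    { specialize (Hc K); repeat apply Rdiv_lt_0_compat; lra. }
    exists (N1 + N2)%nat; intros N HN; simpl.
    specialize (HN1 N ltac:(lia)); specialize (HN2 N ltac:(lia)).
    assert (Ht : Cmod (alpha K) <= Cmod (u K N) + e / 2 / (c K + 1)).
    { replace (alpha K) with (u K N - (u K N - alpha K))%C by ring.
      eapply Rle_trans; [apply Cmod_triangle|]; rewrite Cmod_opp; lra. }
    specialize (Hc K); generalize (Rmult_le_compat_r _ _ _ Hc Ht).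
    assert (e / 2 / (c K + 1) * c K <= e / 2).
    { apply Rle_trans with (e / 2 / (c K + 1) * (c K + 1)); [|right; field; lra].
      apply Rmult_le_compat_l; [|lra].
      left; repeat apply Rdiv_lt_0_compat; lra. }
    lra. }
  apply Rle_plus_epsilon; intros e He; destruct (Heps e He) as [N0 HN0].
  specialize (HN0 N0 (Nat.le_refl _)); specialize (HS N0); lra.
Qed.

(** The Weierstrass theorem for the coefficient norm. Since [|a_(n,k)| r^k <= M n], each column of
    coefficients converges absolutely; the column sums [alpha] are the coefficients of [F], and
    [alpha 1] is the termwise derivative. *)
Lemma disc_analytic_series (z0 : C) (r : R) (f : nat -> C -> C) (d : nat -> C) (M : nat -> R) (S : R)
  (F : C -> C) :
  0 < r -> (forall n : nat, disc_analytic z0 r (f n) (d n) (M n)) -> (forall N : nat, Rsum M N <= S) ->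
  (forall z : C, Cmod (z - z0)%C <= r -> is_Cseries (fun n => f n z) (F z)) ->
  exists D : C, is_Cseries d D /\ disc_analytic z0 r F D S.
Proof.
  intros Hr Hf HS HF.
  assert (Hr0 : 0 <= r) by lra.
  destruct (choice (fun n a =>
    a 1%nat = d n /\
    (forall K : nat, Rsum (fun k => Cmod (a k) * r ^ k) K <= M n) /\
    (forall z : C, Cmod (z - z0)%C <= r -> is_Cseries (fun k => a k * (z - z0) ^ k)%C (f n z))) Hf)
    as [a Ha].
  assert (Hterm : forall n k, Cmod (a n k) * r ^ k <= M n).
  { intros n k; apply (Rsum_term (fun k => Cmod (a n k) * r ^ k));
      [intros; now apply Cmod_coef_ge_0|apply Ha]. }
  assert (Hcol : forall k, exists l, is_Cseries (fun n => a n k) l).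
  { intros k; assert (Hrk : 0 < r ^ k) by now apply pow_lt.
    destruct (is_Cseries_dominated (fun n => a n k) (fun n => / r ^ k * M n) (/ r ^ k * S))
      as [l [Hl _]]; [| |now exists l].
    - intros n; apply Rmult_le_reg_l with (r ^ k); [easy|].
      rewrite <- Rmult_assoc, Rinv_r, Rmult_1_l by lra.
      rewrite Rmult_comm; apply Hterm.
    - intros n; rewrite Rsum_scal; apply Rmult_le_compat_l; [|easy].
      left; now apply Rinv_0_lt_compat. }
  apply choice in Hcol; destruct Hcol as [alpha Halpha].
  exists (alpha 1%nat); split.
  - apply is_Cseries_ext with (2 := Halpha 1%nat); intros n; apply Ha.
  - exists alpha; repeat split.
    + intros K; apply (Rsum_Cmod_lim_le (fun k N => Csum (fun n => a n k) N)).
      * intros; now apply pow_le.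
      * apply Halpha.
      * intros N; apply Rle_trans with (2 := HS N).
        apply Rle_trans with (Rsum (fun k => Rsum (fun n => Cmod (a n k) * r ^ k) N) K).
        -- apply Rsum_le; intros k _.
           rewrite (Rsum_ext _ (fun n => r ^ k * Cmod (a n k))) by (intros; ring).
           rewrite Rsum_scal, Rmult_comm.
           apply Rmult_le_compat_l; [now apply pow_le|apply Cmod_Csum_le].
        -- rewrite Rsum_swap; apply Rsum_le; intros n _; apply Ha.
    + intros z Hz.
      (* The remainder of [F] after [K] coefficients is the sum over [n] of the remainders of [f n].
         Each of these tends to zero and is at most [M n], so Tannery's theorem applies. *)
      assert (Hl : Clim (fun K => F z - Csum (fun k => alpha k * (z - z0) ^ k)%C K)%C (RtoC 0)).
      { apply (is_Cseries_dominated_limit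
          (fun K n => f n z - Csum (fun k => a n k * (z - z0) ^ k)%C K)%C M S).
        - intros K n; eapply Rle_trans.
          + apply (is_Cseries_tail_le _ (fun k => Cmod (a n k) * r ^ k) (M n)).
            * intros k; now apply Cmod_term_le.
            * apply Ha.
            * now apply Ha.
          + generalize (Rsum_nonneg (fun k => Cmod (a n k) * r ^ k) K
              (fun k => Cmod_coef_ge_0 (a n k) r k Hr0)); lra.
        - easy.
        - intros n; replace (RtoC 0) with (f n z - f n z)%C by ring.
          apply Clim_minus; [apply Clim_const|now apply Ha].
        - intros K; apply is_Cseries_minus; [now apply HF|].
          apply (is_Cseries_Csum (fun n k => a n k * (z - z0) ^ k)%C).
          intros k; rewrite Cmult_comm; eapply is_Cseries_ext; [|apply (is_Cseries_scal _ _ _ (Halpha k))].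
          intros n; simpl; ring. }
      replace (F z) with (F z - RtoC 0)%C by ring.
      eapply Clim_ext; [|apply (Clim_minus _ _ _ _ (Clim_const (F z)) Hl)].
      intros n; simpl; ring.
Qed.

Lemma pow_n_Cpow (w : C) (k : nat) : pow_n (K := C_AbsRing) w k = (w ^ k)%C.
Proof. induction k as [|k IH]; simpl; [easy|]; now rewrite IH. Qed.

Lemma disc_analytic_analytic_at (z0 : C) (r : R) (f : C -> C) (d : C) (M : R) :
  0 < r -> disc_analytic z0 r f d M -> analytic_at f z0.
Proof.
  intros Hr (a & _ & _ & H); exists a, r; split; [easy|].
  intros z Hz; apply is_Cseries_is_series; eapply is_Cseries_ext; [|apply H; lra].
  intros k; rewrite pow_n_Cpow; apply Cmult_comm.
Qed.

Lemma is_derive_C_intro (f : C -> C) (z0 d : C) :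
  (forall eps : R, 0 < eps -> exists delta : R, 0 < delta /\
     forall z : C, Cmod (z - z0)%C < delta ->
       Cmod (f z - f z0 - (z - z0) * d)%C <= eps * Cmod (z - z0)%C) ->
  is_derive (K := C_AbsRing) (V := C_NormedModule) f z0 d.
Proof.
  intros H; split; [apply is_linear_scal_l|].
  intros x Hx.
  apply (is_filter_lim_locally_unique (V := AbsRing_NormedModule C_AbsRing)) in Hx.
  subst x; intros eps; destruct (H eps (cond_pos eps)) as [delta [Hd HH]].
  exists (mkposreal delta Hd); intros z Hz; apply HH; exact Hz.
Qed.

Lemma disc_analytic_is_derive (z0 : C) (r : R) (f : C -> C) (d : C) (M : R) :
  0 < r -> disc_analytic z0 r f d M -> is_derive (K := C_AbsRing) (V := C_NormedModule) f z0 d.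
Proof.
  intros Hr (a & H1 & H2 & H3).
  assert (Hr0 : 0 <= r) by lra.
  assert (HM : 0 <= M) by exact (H2 O).
  assert (Hf0 : f z0 = a O).
  { apply is_Cseries_at_zero; generalize (H3 z0 (Cmod_center z0 r Hr0)).
    now replace (z0 - z0)%C with (RtoC 0) by ring. }
  apply is_derive_C_intro; intros e He.
  (* The terms from degree two on are at most [(t / r)^2 M]; the second bound makes
     [t M / r^2 <= e], and [M + 1] guards against [M = 0]. *)
  exists (Rmin r (e * r ^ 2 / (M + 1))); split.
  { apply Rmin_pos; [easy|]; apply Rdiv_lt_0_compat; [|lra].
    apply Rmult_lt_0_compat; [easy|now apply pow_lt]. }
  intros z Hz.
  assert (Hz1 : Cmod (z - z0)%C < r) by (eapply Rlt_le_trans; [apply Hz|apply Rmin_l]).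
  assert (Hz2 : Cmod (z - z0)%C < e * r ^ 2 / (M + 1))
    by (eapply Rlt_le_trans; [apply Hz|apply Rmin_r]).
  set (w := (z - z0)%C) in *; set (t := Cmod w) in *.
  assert (Ht : 0 <= t) by apply Cmod_ge_0.
  assert (Hser : is_Cseries (fun k => a (2 + k)%nat * w ^ (2 + k))%C (f z - f z0 - w * d)%C).
  { apply (is_Cseries_incr (fun k => a k * w ^ k)%C _ 2).
    replace (Csum (fun k => a k * w ^ k)%C 2 + (f z - f z0 - w * d))%C with (f z).
    - apply H3, Rlt_le, Hz1.
    - simpl; rewrite Hf0, H1; ring. }
  apply Rle_trans with ((t / r) ^ 2 * M).
  - refine (is_Cseries_norm_le _ (fun k => (t / r) ^ 2 * (Cmod (a (2 + k)%nat) * r ^ (2 + k)))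
      _ _ _ _ Hser).
    + intros k; rewrite Cmod_mult, Cmod_pow; fold t.
      replace ((t / r) ^ 2 * (Cmod (a (2 + k)%nat) * r ^ (2 + k)))
        with (Cmod (a (2 + k)%nat) * (t ^ 2 * r ^ k)) by (rewrite pow_add; field; lra).
      apply Rmult_le_compat_l; [apply Cmod_ge_0|]; rewrite pow_add.
      apply Rmult_le_compat_l; [apply pow2_ge_0|]; apply pow_incr; lra.
    + intros n; rewrite Rsum_scal; apply Rmult_le_compat_l; [apply pow2_ge_0|].
      generalize (H2 (2 + n)%nat); change (2 + n)%nat with (S (S n)); rewrite !Rsum_S.
      generalize (Cmod_coef_ge_0 (a O) r 0 Hr0) (Cmod_coef_ge_0 (a 1%nat) r 1 Hr0); simpl; lra.
  - replace ((t / r) ^ 2 * M) with (t * M / r ^ 2 * t) by (field; lra).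
    apply Rmult_le_compat_r; [easy|].
    apply Rmult_le_reg_r with (r ^ 2); [now apply pow_lt|].
    replace (t * M / r ^ 2 * r ^ 2) with (t * M) by (field; lra).
    apply Rle_trans with (t * (M + 1)); [nra|].
    apply Rle_trans with (e * r ^ 2 / (M + 1) * (M + 1)); [|right; field; lra].
    apply Rmult_le_compat_r; lra.
Qed.

(** * Complex powers and the binomial series *)

Lemma C_ext (x y : C) : fst x = fst y -> snd x = snd y -> x = y.
Proof. destruct x, y; simpl; congruence. Qed.

Lemma Cexp_plus (z w : C) : Cexp (z + w)%C = (Cexp z * Cexp w)%C.
Proof.
  apply C_ext; unfold Cexp; simpl; rewrite exp_plus, ?cos_plus, ?sin_plus; ring.
Qed.

Lemma Cexp_RtoC (x : R) : Cexp (RtoC x) = RtoC (exp x).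
Proof. apply C_ext; unfold Cexp; simpl; rewrite ?cos_0, ?sin_0; ring. Qed.

Lemma Cmod_Cexp (z : C) : Cmod (Cexp z) = exp (fst z).
Proof.
  unfold Cmod, Cexp; simpl.
  replace (exp (fst z) * cos (snd z) * (exp (fst z) * cos (snd z) * 1) +
    exp (fst z) * sin (snd z) * (exp (fst z) * sin (snd z) * 1))
    with (Rsqr (exp (fst z)) * (Rsqr (sin (snd z)) + Rsqr (cos (snd z))))
    by (unfold Rsqr; ring).
  rewrite sin2_cos2, Rmult_1_r; apply sqrt_Rsqr; left; apply exp_pos.
Qed.

Lemma Rpower_C_plus (x : R) (z w : C) : Rpower_C x (z + w)%C = (Rpower_C x z * Rpower_C x w)%C.
Proof. unfold Rpower_C; rewrite <- Cexp_plus; f_equal; ring. Qed.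

Lemma Rpower_C_RtoC (x y : R) : Rpower_C x (RtoC y) = RtoC (exp (y * ln x)).
Proof. unfold Rpower_C; rewrite <- RtoC_mult; apply Cexp_RtoC. Qed.

Lemma Cmod_Rpower_C (x : R) (z : C) : Cmod (Rpower_C x z) = exp (fst z * ln x).
Proof. unfold Rpower_C; rewrite Cmod_Cexp; f_equal; simpl; ring. Qed.

Lemma Rpower_C_base_mult (x y : R) (z : C) :
  0 < x -> 0 < y -> Rpower_C (x * y) z = (Rpower_C x z * Rpower_C y z)%C.
Proof.
  intros Hx Hy; unfold Rpower_C; rewrite <- Cexp_plus, ln_mult, RtoC_plus by easy; f_equal; ring.
Qed.

Lemma Rpower_C_neg_nat (x : R) (n : nat) : 0 < x -> Rpower_C x (- RtoC (INR n))%C = RtoC (/ x ^ n).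
Proof.
  intros Hx; rewrite <- RtoC_opp, Rpower_C_RtoC, Ropp_mult_distr_l_reverse, exp_Ropp.
  now rewrite <- Rpower_pow.
Qed.

(* Coefficients of the solution of [(1 + e t) y' = w y], [y 0 = 1]: the exponential
   series for [e = 0] and the binomial series for [e = 1]. *)
Fixpoint ode_coef (w : C) (e : R) (k : nat) : C :=
  match k with
  | O => RtoC 1
  | S k => (ode_coef w e k * (w - RtoC (e * INR k)) / RtoC (INR (S k)))%C
  end.

Lemma ode_coef_S (w : C) (e : R) (k : nat) :
  (RtoC (INR (S k)) * ode_coef w e (S k))%C = (ode_coef w e k * (w - RtoC (e * INR k)))%C.
Proof.
  cbn [ode_coef]; field; intros H; apply RtoC_inj in H; revert H; apply not_0_INR; lia.
Qed.

Lemma CV_radius_ge (a : nat -> R) (R0 B : R) :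
  (forall k : nat, Rabs (a k * R0 ^ k) <= B) -> Rbar_le R0 (CV_radius a).
Proof.
  intros H; generalize (CV_radius_bounded a); intros [Hub _]; apply Hub; now exists B.
Qed.

(** * Summation of [ode_coef] through its differential equation *)

Section ODE.

Variables (p q e B R0 x : R) (L : R -> R).
Hypothesis HR : 0 <= x < R0.
Hypothesis HB : forall k : nat, Cmod (ode_coef (p, q) e k) * R0 ^ k <= B.
Hypothesis HL0 : L 0 = 0.
Hypothesis HL : forall t : R, 0 <= t <= x -> 1 + e * t <> 0 /\ is_derive L t (/ (1 + e * t)).

Let A (k : nat) : R := fst (ode_coef (p, q) e k).
Let D (k : nat) : R := snd (ode_coef (p, q) e k).

Lemma ode_radius (t : R) : 0 <= t <= x ->
  Rbar_lt (Rabs t) (CV_radius A) /\ Rbar_lt (Rabs t) (CV_radius D).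
Proof.
  intros Ht; rewrite Rabs_pos_eq by lra.
  split; apply Rbar_lt_le_trans with (Finite R0); try (simpl; lra); apply (CV_radius_ge _ _ B);
    intros k; rewrite Rabs_mult, (Rabs_pos_eq (R0 ^ k)) by (apply pow_le; lra);
    apply Rle_trans with (2 := HB k); (apply Rmult_le_compat_r; [apply pow_le; lra|]).
  - apply (re_le_Cmod (ode_coef (p, q) e k)).
  - eapply Rle_trans; [|apply (Rmax_Cmod (ode_coef (p, q) e k))]; apply Rmax_r.
Qed.

(** One real coordinate of [(1 + e t) y' = w y]. It is used with [a, b, c, s] equal to
    [A, D, p, - q] for the real part and to [D, A, p, q] for the imaginary part. *)
Lemma PSeries_ode (a b : nat -> R) (c s t : R) :
  Rbar_lt (Rabs t) (CV_radius a) -> Rbar_lt (Rabs t) (CV_radius b) ->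
  (forall k : nat, INR (S k) * a (S k) + e * INR k * a k = c * a k + s * b k) ->
  (1 + e * t) * PSeries (PS_derive a) t = c * PSeries a t + s * PSeries b t.
Proof.
  intros Ha Hb H.
  assert (E : is_pseries (K := R_AbsRing) (V := R_NormedModule)
    (fun k => c * a k + s * b k) t (c * PSeries a t + s * PSeries b t)).
  { apply (is_pseries_plus (V := R_NormedModule) (fun k => c * a k) (fun k => s * b k));
      apply (is_pseries_scal (V := R_NormedModule)); try apply Rmult_comm;
      now apply PSeries_correct, CV_radius_inside. }
  apply is_pseries_unique in E; rewrite <- E.
  assert (F : is_pseries (K := R_AbsRing) (V := R_NormedModule) (PS_derive a) t
    (PSeries (PS_derive a) t)) by now apply PSeries_correct, ex_pseries_derive.
  assert (G : is_pseries (K := R_AbsRing) (V := R_NormedModule)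
    (PS_plus (PS_derive a) (PS_scal e (PS_incr_1 (PS_derive a)))) t
    (PSeries (PS_derive a) t + e * (t * PSeries (PS_derive a) t))).
  { apply (is_pseries_plus (V := R_NormedModule)); [easy|].
    apply (is_pseries_scal (V := R_NormedModule)); [apply Rmult_comm|].
    now apply (is_pseries_incr_1 (V := R_NormedModule)). }
  apply is_pseries_unique in G; replace ((1 + e * t) * PSeries (PS_derive a) t) with
    (PSeries (PS_derive a) t + e * (t * PSeries (PS_derive a) t)) by ring.
  rewrite <- G; apply PSeries_ext; intros k; rewrite <- H.
  unfold PS_plus, PS_scal, PS_derive, PS_incr_1; unfold plus, scal; simpl.
  unfold mult; simpl; destruct k as [|k]; simpl; [unfold zero; simpl|]; ring.
Qed.

Lemma ode_coef_fst (k : nat) : INR (S k) * A (S k) + e * INR k * A k = p * A k + - q * D k.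
Proof.
  generalize (f_equal fst (ode_coef_S (p, q) e k)).
  change (A k) with (fst (ode_coef (p, q) e k)); change (D k) with (snd (ode_coef (p, q) e k)).
  change (A (S k)) with (fst (ode_coef (p, q) e (S k))).
  unfold Cmult, Cminus, Cplus, Copp, RtoC; cbn [fst snd]; lra.
Qed.

Lemma ode_coef_snd (k : nat) : INR (S k) * D (S k) + e * INR k * D k = p * D k + q * A k.
Proof.
  generalize (f_equal snd (ode_coef_S (p, q) e k)).
  change (A k) with (fst (ode_coef (p, q) e k)); change (D k) with (snd (ode_coef (p, q) e k)).
  change (D (S k)) with (snd (ode_coef (p, q) e (S k))).
  unfold Cmult, Cminus, Cplus, Copp, RtoC; cbn [fst snd]; lra.
Qed.

(** The two expressions are the real and imaginary parts of [y(x) exp (- w L(x))] with [y = A + i D]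
    and [w = p + i q]. As [L' = 1 / (1 + e t)], the differential equation makes the derivative
    vanish, and the value at [0] is [1]. *)
Lemma ode_rotated_constant :
  exp (- p * L x) * (PSeries A x * cos (q * L x) + PSeries D x * sin (q * L x)) = 1 /\
  exp (- p * L x) * (PSeries D x * cos (q * L x) - PSeries A x * sin (q * L x)) = 0.
Proof.
  assert (HA : forall t, 0 <= t <= x -> is_derive (PSeries A) t
    (/ (1 + e * t) * (p * PSeries A t + - q * PSeries D t))).
  { intros t Ht; destruct (ode_radius t Ht) as [R1 R2].
    rewrite <- (PSeries_ode A D p (- q) t R1 R2 ode_coef_fst), <- Rmult_assoc, Rinv_l, Rmult_1_l
      by now apply HL.
    now apply is_derive_PSeries. }
  assert (HD : forall t, 0 <= t <= x -> is_derive (PSeries D) t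
    (/ (1 + e * t) * (p * PSeries D t + q * PSeries A t))).
  { intros t Ht; destruct (ode_radius t Ht) as [R1 R2].
    rewrite <- (PSeries_ode D A p q t R2 R1 ode_coef_snd), <- Rmult_assoc, Rinv_l, Rmult_1_l
      by now apply HL.
    now apply is_derive_PSeries. }
  assert (HA0 : PSeries A 0 = 1) by (rewrite PSeries_0; reflexivity).
  assert (HD0 : PSeries D 0 = 0) by (rewrite PSeries_0; reflexivity).
  set (f1 := fun t => exp (- p * L t) * (PSeries A t * cos (q * L t) + PSeries D t * sin (q * L t))).
  set (f2 := fun t => exp (- p * L t) * (PSeries D t * cos (q * L t) - PSeries A t * sin (q * L t))).
  assert (E1 : f1 0 = 1).
  { unfold f1; rewrite HL0, HA0, HD0, !Rmult_0_r, exp_0, cos_0, sin_0; ring. }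
  assert (E2 : f2 0 = 0).
  { unfold f2; rewrite HL0, HA0, HD0, !Rmult_0_r, exp_0, cos_0, sin_0; ring. }
  destruct (Req_dec x 0) as [->|Hx]; [now split|].
  split; [change (f1 x = 1); transitivity (f1 0)|change (f2 x = 0); transitivity (f2 0)];
    try easy; symmetry; apply (eq_is_derive (V := R_NormedModule)); try lra; intros t Ht;
    destruct (HL t Ht) as [Hnz HLt]; specialize (HA t Ht); specialize (HD t Ht).
  - unfold f1; auto_derive.
    + repeat split; try (eexists; eassumption).
    + replace (Derive (fun x0 => L x0) t) with (/ (1 + e * t))
        by (symmetry; now apply is_derive_unique).
      replace (Derive (fun x0 => PSeries A x0) t) with
        (/ (1 + e * t) * (p * PSeries A t + - q * PSeries D t))
        by (symmetry; now apply is_derive_unique).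
      replace (Derive (fun x0 => PSeries D x0) t) with
        (/ (1 + e * t) * (p * PSeries D t + q * PSeries A t))
        by (symmetry; now apply is_derive_unique).
      unfold zero; simpl; ring.
  - unfold f2; auto_derive.
    + repeat split; try (eexists; eassumption).
    + replace (Derive (fun x0 => L x0) t) with (/ (1 + e * t))
        by (symmetry; now apply is_derive_unique).
      replace (Derive (fun x0 => PSeries A x0) t) with
        (/ (1 + e * t) * (p * PSeries A t + - q * PSeries D t))
        by (symmetry; now apply is_derive_unique).
      replace (Derive (fun x0 => PSeries D x0) t) with
        (/ (1 + e * t) * (p * PSeries D t + q * PSeries A t))
        by (symmetry; now apply is_derive_unique).
      unfold zero; simpl; ring.
Qed.

Lemma is_Cseries_ode : is_Cseries (fun k => ode_coef (p, q) e k * RtoC (x ^ k))%C (Cexp ((p, q) * RtoC (L x))%C).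
Proof.
  destruct ode_rotated_constant as [E1 E2].
  assert (Hdom : exists l, is_Cseries (fun k => ode_coef (p, q) e k * RtoC (x ^ k))%C l).
  { destruct (is_Cseries_dominated (fun k => ode_coef (p, q) e k * RtoC (x ^ k))%C
      (fun k => B * (x / R0) ^ k) (B / (1 - x / R0))) as [l [Hl _]]; [| |now exists l].
    - intros k; rewrite Cmod_mult, Cmod_R, Rabs_pos_eq by (apply pow_le; lra).
      replace (x ^ k) with (R0 ^ k * (x / R0) ^ k)
        by (rewrite <- Rpow_mult_distr; f_equal; field; lra).
      rewrite <- Rmult_assoc; apply Rmult_le_compat_r; [|apply HB].
      apply pow_le; apply Rmult_le_pos; [lra|left; apply Rinv_0_lt_compat; lra].
    - intros n; rewrite Rsum_scal; unfold Rdiv at 2.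
      assert (HB0 : 0 <= B).
      { apply Rle_trans with (2 := HB O); apply Cmod_coef_ge_0; lra. }
      apply Rmult_le_compat_l; [easy|].
      assert (Hq : 0 <= x / R0 < 1).
      { split; [apply Rmult_le_pos; [lra|left; apply Rinv_0_lt_compat; lra]|].
        apply Rmult_lt_reg_r with R0; [lra|]; unfold Rdiv; rewrite Rmult_assoc, Rinv_l; lra. }
      set (y := x / R0) in *.
      apply Rmult_le_reg_l with (1 - y); [lra|]; rewrite Rinv_r by lra.
      assert (G : (1 - y) * Rsum (fun k => y ^ k) n = 1 - y ^ n).
      { clear; induction n as [|n IH]; simpl; [ring|]; rewrite Rmult_plus_distr_l, IH; ring. }
      change (pow y) with (fun k => y ^ k); rewrite G; generalize (pow_le y n ltac:(lra)); lra. }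
  destruct Hdom as [l Hl].
  assert (Hc : l = (PSeries A x, PSeries D x)).
  { assert (Hs := proj1 (is_Cseries_is_series _ _) Hl).
    (* [h] stands for either coordinate: an additive map dominated by [Cmod] carries the complex sum
       to a real power series. *)
    assert (Hcomp : forall (h : C -> R) (a : nat -> R), 
      (forall u v, h (u + v)%C = h u + h v) -> (forall u, Rabs (h u) <= Cmod u) ->
      (forall k, h (ode_coef (p, q) e k * RtoC (x ^ k))%C = x ^ k * a k) -> PSeries a x = h l).
    { intros h a Hadd Hle Hk; apply is_pseries_unique.
      assert (h0 : h (RtoC 0) = 0).
      { generalize (Hadd (RtoC 0) (RtoC 0)); replace (RtoC 0 + RtoC 0)%C with (RtoC 0) by ring; lra. }
      assert (hm : forall u v, h (u - v)%C = h u - h v).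
      { intros u v; generalize (Hadd (u - v)%C v); replace (u - v + v)%C with u by ring; lra. }
      assert (Hsum : forall n, sum_n (fun k => scal (pow_n (K := R_AbsRing) x k) (a k)) n =
        h (Csum (fun k => ode_coef (p, q) e k * RtoC (x ^ k))%C (S n))).
      { induction n as [|n IH].
        - rewrite sum_O; cbn [Csum]; rewrite Hadd, h0, Hk, Rplus_0_l, pow_n_pow; reflexivity.
        - rewrite sum_Sn, IH; set (F := fun k => (ode_coef (p, q) e k * RtoC (x ^ k))%C).
          change (Csum F (S (S n))) with (Csum F (S n) + F (S n))%C.
          rewrite Hadd; unfold F at 3; rewrite Hk, pow_n_pow; reflexivity. }
      refine (proj2 (@filterlim_locally_ball_norm R_AbsRing nat R_NormedModule eventually _ _ (h l)) _).
      intros eps; destruct (Hl eps (cond_pos eps)) as [N HN]; exists N; intros n Hn.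
      unfold ball_norm; rewrite Hsum; unfold minus, plus, opp; simpl.
      eapply Rle_lt_trans; [|apply (HN (S n)); lia].
      eapply Rle_trans; [|apply Hle]; rewrite hm; cbn [Csum]; right; reflexivity. }
    apply C_ext; symmetry.
    - apply (Hcomp (fun u => fst u)); [easy|apply re_le_Cmod|].
      intros k; unfold A; simpl; ring.
    - apply (Hcomp (fun u => snd u)); [easy| |].
      + intros u; eapply Rle_trans; [|apply Rmax_Cmod]; apply Rmax_r.
      + intros k; unfold D; simpl; ring. }
  replace (Cexp ((p, q) * RtoC (L x))%C) with l; [easy|].
  rewrite Hc; set (u := PSeries A x) in *; set (v := PSeries D x) in *.
  assert (Hexp : exp (p * L x) * exp (- p * L x) = 1).
  { rewrite <- exp_plus, <- exp_0; f_equal; ring. }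
  assert (Hcs : sin (q * L x) * sin (q * L x) + cos (q * L x) * cos (q * L x) = 1)
    by exact (sin2_cos2 (q * L x)).
  unfold Cexp; simpl; rewrite !Rmult_0_r, Rminus_0_r, Rplus_0_l.
  set (c := cos (q * L x)) in *; set (s := sin (q * L x)) in *.
  set (E := exp (p * L x)) in *; set (E' := exp (- p * L x)) in *.
  (* The rotation is undone: [E * E' = 1] and [s * s + c * c = 1] recover [u] and [v] from the
     constants in [E1] and [E2]. *)
  apply C_ext; simpl.
  - transitivity ((E * E') * u * (s * s + c * c)); [rewrite Hexp, Hcs; ring|].
    transitivity (E * (E' * (u * c + v * s) * c - E' * (v * c - u * s) * s)); [ring|].
    rewrite E1, E2; ring.
  - transitivity ((E * E') * v * (s * s + c * c)); [rewrite Hexp, Hcs; ring|].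
    transitivity (E * (E' * (u * c + v * s) * s + E' * (v * c - u * s) * c)); [ring|].
    rewrite E1, E2; ring.
Qed.

End ODE.

Lemma exp_coef (w : C) (k : nat) : Cmod (ode_coef w 0 k) = Cmod w ^ k / INR (fact k).
Proof.
  induction k as [|k IH]; [simpl; rewrite Cmod_1; field|].
  assert (Hk : INR (S k) <> 0) by (apply not_0_INR; lia).
  assert (Hf : INR (fact k) <> 0) by apply INR_fact_neq_0.
  assert (E : Cmod (RtoC (INR (S k)) * ode_coef w 0 (S k))%C
    = Cmod (ode_coef w 0 k * (w - RtoC (0 * INR k)))%C) by (f_equal; apply ode_coef_S).
  rewrite !Cmod_mult, Cmod_R, Rabs_pos_eq, IH in E by (apply pos_INR).
  rewrite Rmult_0_l in E; replace (w - RtoC 0)%C with w in E by ring.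
  change (fact (S k)) with (S k * fact k)%nat; rewrite mult_INR; cbn [pow].
  apply Rmult_eq_reg_l with (INR (S k)); [|easy]; rewrite E; now field.
Qed.

Lemma Rsum_exp_le (y : R) (n : nat) : 0 <= y -> Rsum (fun k => y ^ k / INR (fact k)) n <= exp y.
Proof.
  intros Hy; destruct n as [|n]; [left; apply exp_pos|].
  apply Rle_trans with (2 := exp_ge_taylor y n Hy); right.
  induction n as [|n IH]; [simpl; ring|].
  rewrite tech5, <- IH; reflexivity.
Qed.

Lemma is_Cseries_exp (w : C) : is_Cseries (ode_coef w 0) (Cexp w).
Proof.
  replace w with (w * RtoC 1)%C at 2 by ring.
  apply is_Cseries_ext with (fun k => ode_coef w 0 k * RtoC (1 ^ k))%C.
  { intros n; rewrite pow1; ring. }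
  destruct w as [p q].
  (* The series is evaluated at [x = 1] inside the radius [R0 = 2]; there each coefficient bound is
     a single term of the real series for [exp (2 |w|)]. *)
  apply (is_Cseries_ode p q 0 (exp (Cmod (p, q) * 2)) 2 1 (fun t => t)); [lra| |easy|].
  - intros k; rewrite exp_coef; unfold Rdiv; rewrite Rmult_assoc, (Rmult_comm (/ _)), <- Rmult_assoc.
    rewrite <- Rpow_mult_distr.
    apply (Rsum_term (fun k => (Cmod (p, q) * 2) ^ k / INR (fact k))).
    + intros j; apply Rmult_le_pos; [|left; apply Rinv_0_lt_compat, INR_fact_lt_0].
      apply pow_le; generalize (Cmod_ge_0 (p, q)); lra.
    + intros K; apply Rsum_exp_le; generalize (Cmod_ge_0 (p, q)); lra.
  - intros t Ht; split; [lra|]; auto_derive; [easy|field].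
Qed.

Definition Cbin (w : C) (k : nat) : C := ode_coef w 1 k.

(** From [|w - k| <= K (k + 1)] the coefficients satisfy [|Cbin w k| <= K^k], so the radius is at
    least [1 / K]. This crude radius is enough because the series is applied at [1 / x] with [x]
    large. *)
Lemma is_Cseries_binomial (w : C) (K x : R) :
  1 <= K -> Cmod w <= K -> 0 <= x -> x * K < 1 ->
  is_Cseries (fun k => Cbin w k * RtoC (x ^ k))%C (Rpower_C (1 + x) w).
Proof.
  intros HK Hw Hx HxK; unfold Rpower_C, Cbin; destruct w as [p q].
  assert (HR : x < / K).
  { apply Rmult_lt_reg_r with K; [lra|]; rewrite Rinv_l; lra. }
  apply (is_Cseries_ode p q 1 1 (/ K) x (fun t => ln (1 + t))); [lra| | |].
  - induction k as [|k IH]; [simpl; rewrite Cmod_1; lra|].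
    assert (Hk : 0 < INR (S k)) by (apply lt_0_INR; lia).
    assert (Hk0 := pos_INR k).
    assert (E : Cmod (RtoC (INR (S k)) * ode_coef (p, q) 1 (S k))%C
      = Cmod (ode_coef (p, q) 1 k * ((p, q) - RtoC (1 * INR k)))%C) by (f_equal; apply ode_coef_S).
    rewrite !Cmod_mult, Cmod_R, Rabs_pos_eq in E by lra.
    assert (Hb : Cmod ((p, q) - RtoC (1 * INR k))%C <= K * INR (S k)).
    { eapply Rle_trans; [apply Cmod_triangle|].
      rewrite Cmod_opp, Cmod_R, Rabs_pos_eq, S_INR by lra; nra. }
    apply Rmult_le_reg_l with (INR (S k)); [easy|].
    rewrite <- Rmult_assoc, E, Rmult_1_r; cbn [pow].
    replace (Cmod (ode_coef (p, q) 1 k) * Cmod ((p, q) - RtoC (1 * INR k))%C * (/ K * (/ K) ^ k))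
      with ((Cmod (ode_coef (p, q) 1 k) * (/ K) ^ k) * (Cmod ((p, q) - RtoC (1 * INR k))%C * / K))
      by ring.
    assert (H0 : 0 <= Cmod ((p, q) - RtoC (1 * INR k))%C * / K).
    { apply Rmult_le_pos; [apply Cmod_ge_0|left; apply Rinv_0_lt_compat; lra]. }
    apply Rle_trans with (1 * (Cmod ((p, q) - RtoC (1 * INR k))%C * / K)).
    + now apply Rmult_le_compat_r.
    + rewrite Rmult_1_l; apply Rmult_le_reg_r with K; [lra|].
      rewrite Rmult_assoc, Rinv_l by lra; lra.
  - now rewrite Rplus_0_r, ln_1.
  - intros t Ht; split; [lra|]; auto_derive; [lra|field; lra].
Qed.

Lemma exp_coef_mult (l w : C) (k : nat) : ode_coef (w * l)%C 0 k = (ode_coef l 0 k * w ^ k)%C.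
Proof.
  induction k as [|k IH]; [simpl; ring|].
  assert (Hk : RtoC (INR (S k)) <> RtoC 0).
  { intros H; apply RtoC_inj in H; revert H; apply not_0_INR; lia. }
  cbn [ode_coef]; rewrite IH, Cpow_S, Rmult_0_l; field; easy.
Qed.

(** Expand [x^(-z) = x^(-z0) exp (- (z - z0) ln x)]; the norm is [x^(- Re z0)] times partial sums of
    [exp (|ln x| r)]. *)
Lemma disc_analytic_Rpower_C (z0 : C) (r x : R) : 0 <= r ->
  disc_analytic z0 r (fun z => Rpower_C x (- z)%C) (- (RtoC (ln x) * Rpower_C x (- z0)))%C
    (exp (- fst z0 * ln x + Rabs (ln x) * r)).
Proof.
  intros Hr; exists (fun k => Rpower_C x (- z0)%C * ode_coef (- RtoC (ln x))%C 0 k)%C.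
  repeat split.
  - cbn [ode_coef]; rewrite Rmult_0_l; change (INR 1) with 1; field; apply C1_nz.
  - intros K; rewrite (Rsum_ext _ (fun k => exp (- fst z0 * ln x) *
      ((Rabs (ln x) * r) ^ k / INR (fact k)))).
    + rewrite Rsum_scal, exp_plus; apply Rmult_le_compat_l; [left; apply exp_pos|].
      apply Rsum_exp_le; apply Rmult_le_pos; [apply Rabs_pos|easy].
    + intros k _; rewrite Cmod_mult, Cmod_Rpower_C, exp_coef, Cmod_opp, Cmod_R, Rpow_mult_distr.
      simpl; unfold Rdiv; ring.
  - intros z Hz; replace (- z)%C with (- z0 + - (z - z0))%C by ring.
    rewrite Rpower_C_plus.
    apply is_Cseries_ext with
      (fun k => Rpower_C x (- z0)%C * ode_coef ((z - z0) * - RtoC (ln x))%C 0 k)%C.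
    { intros n; rewrite exp_coef_mult; ring. }
    apply is_Cseries_scal; unfold Rpower_C.
    replace (- (z - z0) * RtoC (ln x))%C with ((z - z0) * - RtoC (ln x))%C by ring.
    apply is_Cseries_exp.
Qed.

(** * Euler-Maclaurin summation of complex powers *)

Fixpoint nbin (n k : nat) : nat :=
  match n, k with
  | _, O => 1
  | O, S _ => 0
  | S n, S k => nbin n k + nbin n (S k)
  end.

Lemma nbin_0_r (n : nat) : nbin n 0 = 1%nat.
Proof. now destruct n. Qed.

Lemma nbin_gt (n k : nat) : (n < k)%nat -> nbin n k = 0%nat.
Proof.
  revert k; induction n as [|n IH]; intros [|k] H; try lia; simpl; [easy|].
  now rewrite !IH by lia.
Qed.

Lemma nbin_diag (n : nat) : nbin n n = 1%nat.
Proof. induction n as [|n IH]; simpl; [easy|]; now rewrite IH, nbin_gt by lia. Qed.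

Lemma nbin_pred (n : nat) : nbin (S n) n = S n.
Proof.
  induction n as [|n IH]; [easy|].
  change (nbin (S n) n + nbin (S n) (S n) = S (S n))%nat; rewrite IH, nbin_diag; lia.
Qed.

Lemma nbin_le (n k : nat) : INR (nbin n k) <= 2 ^ n.
Proof.
  revert k; induction n as [|n IH]; intros [|k]; try (simpl; lra).
  - rewrite nbin_0_r; apply pow_R1_Rle; lra.
  - cbn [nbin pow]; rewrite plus_INR; generalize (IH k) (IH (S k)); lra.
Qed.

Lemma nbin_fact (n k i : nat) :
  (k + i)%nat = n -> (nbin n k * (fact k * fact i) = fact n)%nat.
Proof.
  revert k i; induction n as [|n IH]; intros k i H.
  - now replace k with O by lia; replace i with O by lia.
  - destruct k as [|k]; [rewrite nbin_0_r; replace i with (S n) by lia; cbn [fact]; lia|].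
    destruct i as [|i]; [replace (S k) with (S n) by lia; rewrite nbin_diag; cbn [fact]; lia|].
    assert (H1 := IH k (S i) ltac:(lia)); assert (H2 := IH (S k) i ltac:(lia)).
    change (fact (S n)) with (S n * fact n)%nat.
    replace (S n) with (S k + S i)%nat at 2 by lia.
    rewrite Nat.mul_add_distr_r; rewrite <- H1 at 1; rewrite <- H2.
    cbn [nbin].
    change (fact (S k)) with (S k * fact k)%nat.
    change (fact (S i)) with (S i * fact i)%nat.
    ring.
Qed.

Lemma nbin_step (k i : nat) :
  (S i * nbin (S (k + i)) k = S (k + i) * nbin (k + i) k)%nat.
Proof.
  assert (H1 := nbin_fact (k + i) k i eq_refl).
  assert (H2 := nbin_fact (S (k + i)) k (S i) ltac:(lia)).
  change (fact (S (k + i))) with (S (k + i) * fact (k + i))%nat in H2.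
  change (fact (S i)) with (S i * fact i)%nat in H2.
  rewrite <- H1 in H2.
  assert (Hp : (fact k * fact i <> 0)%nat)
    by (generalize (fact_neq_0 k) (fact_neq_0 i); nia).
  apply (Nat.mul_cancel_r _ _ _ Hp); lia.
Qed.

Lemma RtoC_INR_S_neq_0 (k : nat) : RtoC (INR (S k)) <> RtoC 0.
Proof. intros H; apply RtoC_inj in H; revert H; apply not_0_INR; lia. Qed.

Lemma Cbin_S (w : C) (k : nat) :
  Cbin w (S k) = (Cbin w k * (w - RtoC (INR k)) / RtoC (INR (S k)))%C.
Proof. unfold Cbin; cbn [ode_coef]; now rewrite Rmult_1_l. Qed.

(** This identity makes the binomial expansion of a shifted term of order [k] a combination of
    unshifted terms of orders [k + i], with weights that do not depend on [z]. *)
Lemma Cbin_mult (w : C) (k i : nat) :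
  (Cbin w k * Cbin (w - RtoC (INR k)) i)%C = (RtoC (INR (nbin (k + i) k)) * Cbin w (k + i))%C.
Proof.
  induction i as [|i IH].
  - rewrite Nat.add_0_r, nbin_diag; unfold Cbin; simpl; ring.
  - rewrite Nat.add_succ_r, !Cbin_S.
    assert (H := f_equal INR (nbin_step k i)); rewrite !mult_INR in H.
    apply (f_equal RtoC) in H; rewrite !RtoC_mult in H.
    assert (Hi := RtoC_INR_S_neq_0 i); assert (Hki := RtoC_INR_S_neq_0 (k + i)).
    replace (w - RtoC (INR k) - RtoC (INR i))%C with (w - RtoC (INR (k + i)))%C
      by (rewrite plus_INR, RtoC_plus; ring).
    set (u := (w - RtoC (INR (k + i)))%C).
    transitivity ((Cbin w k * Cbin (w - RtoC (INR k)) i) * u / RtoC (INR (S i)))%C; [now field|].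
    rewrite IH.
    transitivity ((RtoC (INR (S i)) * RtoC (INR (nbin (S (k + i)) k))) * Cbin w (k + i) * u /
      (RtoC (INR (S (k + i))) * RtoC (INR (S i))))%C; [rewrite H|]; now field.
Qed.

(* Bernoulli numbers, with the convention [B_1 = - 1 / 2]. *)
Fixpoint bern_table (n k : nat) : R :=
  match n with
  | O => 1
  | S m =>
      if Nat.leb k m then bern_table m k
      else - Rsum (fun i => INR (nbin (S (S m)) i) * bern_table m i) (S m) / INR (S (S m))
  end.

(** Course-of-values recursion: the table of index [n] is correct at every index up to [n], so the
    diagonal reads off the sequence. *)
Definition bern (k : nat) : R := bern_table k k.

Lemma bern_table_eq (n k : nat) : (k <= n)%nat -> bern_table n k = bern k.
Proof.
  intros H; induction H as [|n H IH]; [easy|].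
  cbn [bern_table]; rewrite (proj2 (Nat.leb_le k n) H); exact IH.
Qed.

Lemma bern_rec (l : nat) :
  (2 <= l)%nat -> Rsum (fun k => INR (nbin l k) * bern k) l = 0.
Proof.
  intros Hl; destruct l as [|[|m]]; try lia.
  set (f := fun k => INR (nbin (S (S m)) k) * bern k).
  change (Rsum f (S m) + f (S m) = 0).
  assert (E : f (S m) = - Rsum f (S m)).
  { unfold f at 1; rewrite nbin_pred; unfold bern; cbn [bern_table].
    rewrite (proj2 (Nat.leb_gt (S m) m)) by lia.
    rewrite (Rsum_ext _ f); [field; apply not_0_INR; lia|].
    intros k Hk; unfold f; now rewrite bern_table_eq by lia. }
  lra.
Qed.

Lemma bern_0 : bern 0 = 1.
Proof. reflexivity. Qed.

Lemma bern_1 : bern 1 = - (1 / 2).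
Proof. generalize (bern_rec 2 ltac:(lia)); simpl; rewrite bern_0; lra. Qed.

Lemma bern_2 : bern 2 = 1 / 6.
Proof. generalize (bern_rec 3 ltac:(lia)); simpl; rewrite bern_0, bern_1; lra. Qed.

Lemma bern_3 : bern 3 = 0.
Proof. generalize (bern_rec 4 ltac:(lia)); simpl; rewrite bern_0, bern_1, bern_2; lra. Qed.

(** * Euler-Maclaurin terms and their defect *)

(** The power [x^(1-z-k)] is split so that [z] enters only through [x^(-z)] and the polynomial
    [Cbin (1 - z) k]. *)
Definition em_term (k : nat) (z : C) (x : R) : C :=
  (RtoC (x * / x ^ k) * (Cbin (RtoC 1 - z) k * Rpower_C x (- z)))%C.

(* [em_sum m z x] is the sum of the [B_k binomial(1-z, k) x^(1-z-k)] for [k < m]: the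
   Euler-Maclaurin approximation of [(z-1) sum_n (n+x)^(-z)]. *)
Definition em_sum (m : nat) (z : C) (x : R) : C :=
  Csum (fun k => RtoC (bern k) * em_term k z x)%C m.

(** The function [W(x) = (z-1) zeta(z, x)] satisfies [W(x) - W(x+1) = (z-1) x^(-z)]; this is the
    defect of [em_sum] in that difference equation. *)
Definition em_error (m : nat) (z : C) (x : R) : C :=
  ((z - RtoC 1) * Rpower_C x (- z) - em_sum m z x + em_sum m z (x + 1))%C.

(** The coefficient of [em_term l] in [em_error m]. The three parts come from [T_m] at [x + 1], from
    [T_m] at [x], and from [(z-1) x^(-z)], which is minus [em_term 1]. *)
Definition em_coef (m l : nat) : R :=
  Rsum (fun k => INR (nbin l k) * bern k) m - (if Nat.ltb l m then bern l else 0)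
  - (if Nat.eqb l 1 then 1 else 0).

Lemma Rsum_truncate (a : nat -> R) (n m : nat) :
  (n <= m)%nat -> (forall k : nat, (n <= k)%nat -> a k = 0) -> Rsum a m = Rsum a n.
Proof.
  intros H Ha; induction H as [|m H IH]; [easy|]; simpl; rewrite IH, Ha by easy; ring.
Qed.

(** For [2 <= l < m] the diagonal term [bern l] cancels and [bern_rec] kills the rest. For [l = m]
    the diagonal term is absent from both sums, so one more order is gained. For [l = 1] the
    surviving [bern 0 = 1] is the indicator. *)
Lemma em_coef_zero (m l : nat) : (2 <= m)%nat -> (l <= m)%nat -> em_coef m l = 0.
Proof.
  intros Hm Hl; unfold em_coef.
  destruct (Nat.eq_dec l m) as [->|Hne].
  - rewrite bern_rec, Nat.ltb_irrefl by easy.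
    rewrite (proj2 (Nat.eqb_neq m 1)) by lia; ring.
  - rewrite (proj2 (Nat.ltb_lt l m)) by lia.
    rewrite (Rsum_truncate _ (S l)).
    2: lia.
    2: intros k Hk; rewrite nbin_gt by lia; simpl; ring.
    cbn [Rsum]; rewrite nbin_diag.
    destruct l as [|[|l]]; [simpl; ring|simpl; rewrite bern_0; ring|].
    rewrite bern_rec by lia; simpl; ring.
Qed.

Lemma em_coef_bound (m l : nat) :
  (m < l)%nat -> (2 <= m)%nat -> Rabs (em_coef m l) <= Rsum (fun k => Rabs (bern k)) m * 2 ^ l.
Proof.
  intros Hl Hm; unfold em_coef.
  rewrite (proj2 (Nat.ltb_ge l m)), (proj2 (Nat.eqb_neq l 1)), !Rminus_0_r by lia.
  clear Hl Hm; induction m as [|m IH]; simpl; [rewrite Rabs_R0; lra|].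
  eapply Rle_trans; [apply Rabs_triang|]; rewrite Rabs_mult, (Rabs_pos_eq (INR _)) by apply pos_INR.
  generalize (nbin_le l m) (Rabs_pos (bern m)); nra.
Qed.

(** Factor [(x+1)^(1-z-k)] as [x^(1-z-k) (1 + 1/x)^(1-z-k)] and expand the second factor in powers
    of [1 / x]. The series is indexed by the total order [l = k + i]; orders below [k] have weight
    zero, so all [k] share the same basis [em_term l]. *)
Lemma is_Cseries_em_term_shift (m k : nat) (z : C) (x K : R) :
  (k < m)%nat -> 1 <= K -> Cmod (RtoC 1 - z - RtoC (INR k))%C <= K -> K < x ->
  is_Cseries (fun l => RtoC (INR (nbin l k)) * em_term l z x)%C (em_term k z (x + 1)).
Proof.
  intros Hkm HK Hz Hx.
  assert (Hbin := is_Cseries_binomial _ K (/ x) HK Hz (Rlt_le _ _ (Rinv_0_lt_compat x ltac:(lra)))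
    ltac:(apply Rmult_lt_reg_l with x; [lra|]; rewrite <- Rmult_assoc, Rinv_r; lra)).
  apply (is_Cseries_scal (RtoC (x * / x ^ k) * Cbin (RtoC 1 - z) k * Rpower_C x (- z))%C) in Hbin.
  replace (em_term k z (x + 1)) with
    (Csum (fun l => RtoC (INR (nbin l k)) * em_term l z x)%C k +
      RtoC (x * / x ^ k) * Cbin (RtoC 1 - z) k * Rpower_C x (- z) *
      Rpower_C (1 + / x) (RtoC 1 - z - RtoC (INR k)))%C.
  - apply is_Cseries_incr; revert Hbin; apply is_Cseries_ext; intros i.
    unfold em_term; rewrite !(Rinv_pow) by lra; rewrite pow_add, !RtoC_mult.
    transitivity (RtoC x * RtoC ((/ x) ^ k) * RtoC ((/ x) ^ i) * Rpower_C x (- z) *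
      (Cbin (RtoC 1 - z) k * Cbin (RtoC 1 - z - RtoC (INR k)) i))%C; [ring|].
    rewrite Cbin_mult; ring.
  - rewrite (Csum_ext _ (fun _ => RtoC 0)).
    2: intros l Hl; rewrite nbin_gt by easy; simpl; ring.
    rewrite Csum_zero; unfold em_term.
    assert (Hx1 : 0 < 1 + / x) by (generalize (Rinv_0_lt_compat x ltac:(lra)); lra).
    replace (x + 1) with (x * (1 + / x)) by (field; lra).
    rewrite (Rpower_C_base_mult x) by lra.
    replace (RtoC 1 - z - RtoC (INR k))%C with (RtoC 1 + (- z + - RtoC (INR k)))%C by ring.
    rewrite !Rpower_C_plus, Rpower_C_neg_nat, Rpower_C_RtoC, Rmult_1_l, exp_ln by easy.
    rewrite Rpow_mult_distr, Rinv_mult, !RtoC_mult; ring.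
Qed.

Lemma is_Cseries_em_error (m : nat) (z : C) (x K : R) :
  (2 <= m)%nat -> 1 <= K ->
  (forall k : nat, (k < m)%nat -> Cmod (RtoC 1 - z - RtoC (INR k))%C <= K) -> K < x ->
  is_Cseries (fun l => RtoC (em_coef m l) * em_term l z x)%C (em_error m z x).
Proof.
  intros Hm HK Hz Hx.
  assert (H1 : is_Cseries (fun l => Csum (fun k => RtoC (bern k) *
    (RtoC (INR (nbin l k)) * em_term l z x))%C m) (em_sum m z (x + 1))).
  { unfold em_sum.
    assert (H : forall n, (n <= m)%nat -> is_Cseries (fun l => Csum (fun k => RtoC (bern k) *
      (RtoC (INR (nbin l k)) * em_term l z x))%C n)
      (Csum (fun k => RtoC (bern k) * em_term k z (x + 1))%C n)).
    { induction n as [|n IH]; intros Hn; simpl.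
      - apply (is_Cseries_finite (fun _ => RtoC 0) 0); easy.
      - apply is_Cseries_plus; [apply IH; lia|]; apply is_Cseries_scal.
        apply (is_Cseries_em_term_shift m n z x K); auto. }
    now apply H. }
  assert (H2 : is_Cseries (fun l => RtoC (if Nat.ltb l m then bern l else 0) * em_term l z x)%C
    (em_sum m z x)).
  { apply (is_Cseries_finite_eq _ m).
    - intros k Hk; rewrite (proj2 (Nat.ltb_ge k m)) by easy; ring.
    - apply Csum_ext; intros k Hk; now rewrite (proj2 (Nat.ltb_lt k m)). }
  assert (H3 : is_Cseries (fun l => RtoC (if Nat.eqb l 1 then 1 else 0) * em_term l z x)%C
    ((RtoC 1 - z) * Rpower_C x (- z))%C).
  { apply (is_Cseries_finite_eq _ 2).
    - intros k Hk; rewrite (proj2 (Nat.eqb_neq k 1)) by lia; ring.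
    - simpl; unfold em_term, Cbin; simpl.
      replace (x * / (x * 1)) with 1 by (field; lra); rewrite Rmult_0_r; field; apply C1_nz. }
  replace (em_error m z x) with (em_sum m z (x + 1) - em_sum m z x -
    (RtoC 1 - z) * Rpower_C x (- z))%C by (unfold em_error; ring).
  eapply is_Cseries_ext; [|apply (is_Cseries_minus _ _ _ _ (is_Cseries_minus _ _ _ _ H1 H2) H3)].
  intros l; simpl; unfold em_coef; rewrite !RtoC_minus.
  replace (Csum (fun k => RtoC (bern k) * (RtoC (INR (nbin l k)) * em_term l z x))%C m)
    with (RtoC (Rsum (fun k => INR (nbin l k) * bern k)%R m) * em_term l z x)%C; [ring|].
  clear; induction m as [|m IH]; cbn [Rsum Csum]; [ring|].
  rewrite <- IH, RtoC_plus, RtoC_mult; ring.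
Qed.

(** Each factor [(1 - z - l) / (l + 1)] of the binomial coefficient multiplies the norm by at most
    [(|1 - z0| + l + r) / (l + 1) <= K]. *)
Lemma disc_analytic_em_term (l : nat) (z0 : C) (r x K : R) :
  0 <= r -> 0 < x -> 1 + Cmod (RtoC 1 - z0)%C + r <= K ->
  exists d : C, disc_analytic z0 r (fun z => em_term l z x) d
    (x * / x ^ l * (K ^ l * exp (- fst z0 * ln x + Rabs (ln x) * r))).
Proof.
  intros Hr Hx HK; set (E := exp (- fst z0 * ln x + Rabs (ln x) * r)).
  assert (H : exists d, disc_analytic z0 r (fun z => Cbin (RtoC 1 - z) l * Rpower_C x (- z))%C d (K ^ l * E)).
  { induction l as [|l [d IH]].
    - eexists; eapply disc_analytic_ext; [| | |apply (disc_analytic_Rpower_C z0 r x Hr)];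
        [|reflexivity|fold E; simpl; lra].
      intros z _; unfold Cbin; simpl; ring.
    - eexists; eapply disc_analytic_ext; [|reflexivity| |
        apply (disc_analytic_scal _ _ (- / RtoC (INR (S l)))%C _ _ _ Hr
          (disc_analytic_mul_lin _ _ (RtoC 1 - RtoC (INR l))%C _ _ _ Hr IH))].
      + intros z _; cbv beta; rewrite Cbin_S; field; apply RtoC_INR_S_neq_0.
      + assert (HE : 0 <= K ^ l * E) by exact (disc_analytic_norm_ge_0 _ _ _ _ _ IH).
        assert (HSl : 0 < INR (S l)) by (apply lt_0_INR; lia).
        rewrite Cmod_opp, <- RtoC_inv, Cmod_R, Rabs_pos_eq
          by (try (left; now apply Rinv_0_lt_compat); lra).
        rewrite <- Rmult_assoc; cbn [pow]; rewrite (Rmult_assoc K).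
        apply Rmult_le_compat_r; [easy|].
        apply Rmult_le_reg_l with (INR (S l)); [easy|].
        rewrite <- Rmult_assoc, Rinv_r, Rmult_1_l by lra.
        replace (z0 - (RtoC 1 - RtoC (INR l)))%C with (- (RtoC 1 - z0) + RtoC (INR l))%C by ring.
        eapply Rle_trans; [apply Rplus_le_compat_r, Cmod_triangle|].
        rewrite Cmod_opp, Cmod_R, Rabs_pos_eq by apply pos_INR.
        rewrite S_INR; generalize (pos_INR l) (Cmod_ge_0 (RtoC 1 - z0)%C); nra. }
  destruct H as [d H]; eexists.
  eapply disc_analytic_ext; [|reflexivity| |apply (disc_analytic_scal _ _ (RtoC (x * / x ^ l)) _ _ _ Hr H)].
  - intros z _; reflexivity.
  - rewrite Cmod_R, Rabs_pos_eq; [lra|].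
    apply Rmult_le_pos; [lra|left; apply Rinv_0_lt_compat, pow_lt; lra].
Qed.

Lemma disc_analytic_em_sum (m : nat) (z0 : C) (r x : R) :
  0 <= r -> 0 < x -> exists (d : C) (M : R), disc_analytic z0 r (fun z => em_sum m z x) d M.
Proof.
  intros Hr Hx; unfold em_sum; induction m as [|m [d [M IH]]].
  - do 2 eexists; apply (disc_analytic_const z0 r (RtoC 0) Hr).
  - destruct (disc_analytic_em_term m z0 r x _ Hr Hx (Rle_refl _)) as [d' H].
    do 2 eexists; apply (disc_analytic_plus _ _ _ _ _ _ _ _ Hr IH (disc_analytic_scal _ _ (RtoC (bern m)) _ _ _ Hr H)).
Qed.

Lemma disc_analytic_em_error (m : nat) (z0 : C) (r x : R) :
  0 <= r -> 0 < x -> exists (d : C) (M : R), disc_analytic z0 r (fun z => em_error m z x) d M.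
Proof.
  intros Hr Hx; destruct (disc_analytic_em_sum m z0 r x Hr Hx) as [d1 [M1 H1]].
  destruct (disc_analytic_em_sum m z0 r (x + 1) Hr ltac:(lra)) as [d2 [M2 H2]].
  do 2 eexists; eapply disc_analytic_ext; [|reflexivity|apply Rle_refl|
    apply (disc_analytic_plus _ _ _ _ _ _ _ _ Hr (disc_analytic_plus _ _ _ _ _ _ _ _ Hr
      (disc_analytic_mul_lin _ _ (RtoC 1) _ _ _ Hr (disc_analytic_Rpower_C z0 r x Hr))
      (disc_analytic_scal _ _ (RtoC (-1)) _ _ _ Hr H1)) H2)].
  intros z _; unfold em_error; cbv beta; ring.
Qed.

Lemma Rsum_geom_tail (y : R) (m n : nat) :
  0 <= y <= / 2 -> Rsum (fun l => if Nat.leb l m then 0 else y ^ l) n <= 2 * y ^ S m.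
Proof.
  intros Hy.
  assert (H : (n <= S m)%nat -> Rsum (fun l => if Nat.leb l m then 0 else y ^ l) n = 0).
  { intros Hn; rewrite (Rsum_ext _ (fun _ => 0)), Rsum_zero; [easy|].
    intros k Hk; now rewrite (proj2 (Nat.leb_le k m)) by lia. }
  assert (Hp := pow_le y (S m) (proj1 Hy)).
  destruct (Nat.le_gt_cases n (S m)) as [Hn|Hn]; [rewrite H by easy; lra|].
  apply Rle_trans with (2 * y ^ S m - 2 * y ^ n).
  2: generalize (pow_le y n (proj1 Hy)); lra.
  clear H; replace n with (S m + (n - S m))%nat by lia; generalize (n - S m)%nat; clear Hn n; intros j.
  induction j as [|j IH].
  - rewrite Nat.add_0_r, (Rsum_ext _ (fun _ => 0)), Rsum_zero; [lra|].
    intros k Hk; now rewrite (proj2 (Nat.leb_le k m)) by lia.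
  - rewrite Nat.add_succ_r; cbn [Rsum]; rewrite (proj2 (Nat.leb_gt (S m + j) m)) by lia.
    assert (HP := pow_le y (S m + j) (proj1 Hy)).
    change (y ^ S (S m + j)) with (y * y ^ (S m + j)); set (P := y ^ (S m + j)) in *; nra.
Qed.

Lemma exp_le_compat (x y : R) : x <= y -> exp x <= exp y.
Proof. intros [H| ->]; [left; now apply exp_increasing|apply Rle_refl]. Qed.

(** Only orders above [m] survive, and the norm of order [l] is at most a constant times
    [x E (2 K / x)^l]. The geometric tail is therefore of size [E x^(-m)], with constants
    independent of [x]. *)
Lemma disc_analytic_em_error_large (m : nat) (z0 : C) (r : R) :
  (2 <= m)%nat -> 0 < r -> 2 <= fst z0 - r + INR m ->
  exists X B : R, 0 < X /\ 0 <= B /\ forall x : R, X <= x ->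
    exists d : C, disc_analytic z0 r (fun z => em_error m z x) d (B * / x ^ 2).
Proof.
  intros Hm Hr Hz0; set (K := 1 + Cmod (RtoC 1 - z0)%C + r + INR m).
  assert (HINR := pos_INR m); assert (Hmod := Cmod_ge_0 (RtoC 1 - z0)%C).
  set (Bm := Rsum (fun k => Rabs (bern k)) m).
  assert (HBm : 0 <= Bm) by (apply Rsum_nonneg; intros; apply Rabs_pos).
  (* [X = 4 K] makes the ratio [2 K / x] at most one half; its [2] comes from [nbin_le], its [K]
     from [disc_analytic_em_term]. *)
  exists (4 * K), (Bm * (2 * (2 * K) ^ S m)); split; [unfold K; lra|].
  assert (HK : 1 <= K) by (unfold K; lra).
  split.
  { apply Rmult_le_pos; [easy|]; apply Rmult_le_pos; [lra|apply pow_le; lra]. }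
  intros x Hx.
  assert (Hx0 : 0 < x) by lra.
  set (E := exp (- fst z0 * ln x + Rabs (ln x) * r)).
  assert (HE0 : 0 < E) by apply exp_pos.
  assert (Hln : 0 <= ln x) by (rewrite <- ln_1; apply ln_le; lra).
  (* As [ln x >= 0], [E] is [x^(r - Re z0)], and the hypothesis on [m] compares the exponents. *)
  assert (HE : E * / x ^ m <= / x ^ 2).
  { unfold E; rewrite Rabs_pos_eq by easy; rewrite <- !Rpower_pow by easy; unfold Rpower.
    rewrite <- !exp_Ropp, <- exp_plus; apply exp_le_compat.
    change (INR 2) with 2; nra. }
  destruct (choice (fun l d => disc_analytic z0 r (fun z => em_term l z x) d
    (x * / x ^ l * (K ^ l * E)))) as [d Hd].
  { intros l; apply disc_analytic_em_term; unfold K; lra. }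
  destruct (disc_analytic_series z0 r (fun l z => RtoC (em_coef m l) * em_term l z x)%C _ _
    (Bm * (2 * (2 * K) ^ S m) * / x ^ 2) (fun z => em_error m z x) Hr
    (fun l => disc_analytic_scal _ _ (RtoC (em_coef m l)) _ _ _ (Rlt_le _ _ Hr) (Hd l))) as [D [_ HD]].
  - intros N.
    apply Rle_trans with (Bm * x * E * Rsum (fun l => if Nat.leb l m then 0 else (2 * K / x) ^ l) N).
    + rewrite <- Rsum_scal; apply Rsum_le; intros l _; rewrite Cmod_R.
      destruct (Nat.le_gt_cases l m) as [Hl|Hl].
      * rewrite em_coef_zero, Rabs_R0, (proj2 (Nat.leb_le l m)) by easy; lra.
      * rewrite (proj2 (Nat.leb_gt l m)) by easy.
        unfold Rdiv; rewrite !Rpow_mult_distr.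
        replace (Bm * x * E * (2 ^ l * K ^ l * (/ x) ^ l)) with
          ((Bm * 2 ^ l) * (x * / x ^ l * (K ^ l * E))) by (rewrite Rinv_pow by lra; ring).
        apply Rmult_le_compat_r; [|now apply em_coef_bound].
        exact (disc_analytic_norm_ge_0 _ _ _ _ _ (Hd l)).
    + assert (Hy : 0 <= 2 * K / x <= / 2).
      { split; [apply Rmult_le_pos; [lra|left; now apply Rinv_0_lt_compat]|].
        apply Rmult_le_reg_r with x; [easy|]; unfold Rdiv; rewrite Rmult_assoc, Rinv_l; lra. }
      apply Rle_trans with (Bm * x * E * (2 * (2 * K / x) ^ S m)).
      * apply Rmult_le_compat_l; [|now apply Rsum_geom_tail].
        repeat apply Rmult_le_pos; lra.
      * replace (Bm * x * E * (2 * (2 * K / x) ^ S m)) with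
          (Bm * (2 * (2 * K) ^ S m) * (E * / x ^ m)).
        -- apply Rmult_le_compat_l; [|easy].
           apply Rmult_le_pos; [easy|]; apply Rmult_le_pos; [lra|apply pow_le; lra].
        -- unfold Rdiv; rewrite (Rpow_mult_distr _ (/ x)), <- Rinv_pow by lra; cbn [pow]; field.
           split; [apply pow_nonzero; lra|lra].
  - intros z Hz; apply (is_Cseries_em_error m z x K); [easy|easy| |lra].
    intros k Hk; replace (RtoC 1 - z - RtoC (INR k))%C with
      ((RtoC 1 - z0) + (- (z - z0) + - RtoC (INR k)))%C by ring.
    eapply Rle_trans; [apply Cmod_triangle|].
    eapply Rle_trans; [apply Rplus_le_compat_l, Cmod_triangle|].
    rewrite !Cmod_opp, Cmod_R, Rabs_pos_eq by apply pos_INR.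
    apply lt_INR in Hk; unfold K; lra.
  - now exists D.
Qed.

Lemma Rsum_inv_sq_le (nu : R) (N : nat) :
  0 < nu -> Rsum (fun n => / (INR n + nu) ^ 2) N <= / nu ^ 2 + / nu.
Proof.
  intros Hnu; destruct N as [|N].
  { simpl; assert (0 < / (nu * (nu * 1))) by (apply Rinv_0_lt_compat; nra).
    generalize (Rinv_0_lt_compat nu Hnu); lra. }
  apply Rle_trans with (/ nu ^ 2 + / nu - / (INR N + nu)).
  2: generalize (pos_INR N); intros; generalize (Rinv_0_lt_compat (INR N + nu) ltac:(lra)); lra.
  induction N as [|N IH]; [simpl; rewrite !Rplus_0_l; lra|].
  change (Rsum (fun n => / (INR n + nu) ^ 2) (S (S N))) with
    (Rsum (fun n => / (INR n + nu) ^ 2) (S N) + / (INR (S N) + nu) ^ 2).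
  assert (H := pos_INR N); rewrite S_INR; set (y := INR N + nu) in *.
  replace (INR N + 1 + nu) with (y + 1) by (unfold y; ring).
  assert (Hy : 0 < y) by (unfold y; lra).
  enough (/ (y + 1) ^ 2 <= / y - / (y + 1)) by lra.
  replace (/ y - / (y + 1)) with (/ (y * (y + 1))) by (field; lra).
  apply Rinv_le_contravar; nra.
Qed.

Lemma em_error_summable (nu : R) (m : nat) (z0 : C) (r : R) :
  0 < nu -> (2 <= m)%nat -> 0 < r -> 2 <= fst z0 - r + INR m ->
  exists (d : nat -> C) (M : nat -> R) (S : R),
    (forall n : nat, disc_analytic z0 r (fun z => em_error m z (INR n + nu)) (d n) (M n)) /\
    (forall N : nat, Rsum M N <= S).
Proof.
  intros Hnu Hm Hr Hz0.
  destruct (disc_analytic_em_error_large m z0 r Hm Hr Hz0) as (X & B & HX & HB & Hlarge).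
  assert (Hpos : forall n, 0 < INR n + nu) by (intros n; generalize (pos_INR n); lra).
  destruct (choice (fun n dM => disc_analytic z0 r (fun z => em_error m z (INR n + nu)) (fst dM) (snd dM)))
    as [dM HdM].
  { intros n; destruct (disc_analytic_em_error m z0 r (INR n + nu) (Rlt_le _ _ Hr) (Hpos n)) as [d [M H]].
    now exists (d, M). }
  (* Beyond [N0] the points [INR n + nu] exceed [X] and the decay estimate applies; the finitely
     many earlier terms need only some finite norm. *)
  destruct (nfloor_ex X ltac:(lra)) as [N0 [_ HN0]].
  assert (Hall : forall n, exists d, disc_analytic z0 r (fun z => em_error m z (INR n + nu)) d
    ((if Nat.leb n N0 then snd (dM n) else 0) + B * / (INR n + nu) ^ 2)).
  { intros n.
    assert (Hq : 0 <= B * / (INR n + nu) ^ 2).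
    { apply Rmult_le_pos; [easy|]; left; apply Rinv_0_lt_compat, pow_lt, Hpos. }
    destruct (Nat.le_gt_cases n N0) as [Hn|Hn].
    - rewrite (proj2 (Nat.leb_le n N0)) by easy; eexists.
      eapply disc_analytic_ext; [reflexivity|reflexivity| |apply HdM]; lra.
    - rewrite (proj2 (Nat.leb_gt n N0)), Rplus_0_l by easy; apply Hlarge.
      apply Nat.le_succ_l, le_INR in Hn; rewrite S_INR in Hn; lra. }
  apply choice in Hall; destruct Hall as [d Hd].
  exists d, (fun n => (if Nat.leb n N0 then snd (dM n) else 0) + B * / (INR n + nu) ^ 2),
    (Rsum (fun n => snd (dM n)) (S N0) + B * (/ nu ^ 2 + / nu)).
  split; [easy|]; intros N; rewrite Rsum_plus, Rsum_scal.
  apply Rplus_le_compat; [|apply Rmult_le_compat_l; [easy|now apply Rsum_inv_sq_le]].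
  assert (HM : forall n, 0 <= snd (dM n)) by (intros n; exact (disc_analytic_norm_ge_0 _ _ _ _ _ (HdM n))).
  apply Rle_trans with (Rsum (fun n => if Nat.leb n N0 then snd (dM n) else 0) (N + S N0)).
  - apply Rsum_incr; [|lia]; intros k; destruct (Nat.leb k N0); [easy|lra].
  - right; rewrite (Rsum_truncate _ (S N0)).
    + apply Rsum_ext; intros k Hk; now rewrite (proj2 (Nat.leb_le k N0)) by lia.
    + lia.
    + intros k Hk; now rewrite (proj2 (Nat.leb_gt k N0)) by lia.
Qed.

(** * The Hurwitz zeta function and its derivative at -1 *)

Lemma exp_neg_ln_small (nu delta eps : R) :
  0 < nu -> 0 < delta -> 0 < eps ->
  exists N : nat, forall n : nat, (N <= n)%nat -> exp (- delta * ln (INR n + nu)) < eps.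
Proof.
  intros Hnu Hd He; set (X := exp (- ln eps / delta)).
  assert (HX : 0 < X) by apply exp_pos.
  destruct (nfloor_ex X ltac:(lra)) as [N [_ HN]].
  exists (S N); intros n Hn; apply le_INR in Hn; rewrite S_INR in Hn.
  rewrite <- (exp_ln eps) at 1 by easy; apply exp_increasing.
  assert (Hl : - ln eps / delta < ln (INR n + nu)).
  { rewrite <- (ln_exp (- ln eps / delta)); fold X; apply ln_increasing; lra. }
  apply (Rmult_lt_compat_l delta) in Hl; [|easy].
  replace (delta * (- ln eps / delta)) with (- ln eps) in Hl by (field; lra); lra.
Qed.

Lemma em_term_vanishes (k : nat) (z : C) (nu : R) :
  0 < nu -> 1 < fst z + INR k -> Clim (fun n => em_term k z (INR n + nu)) (RtoC 0).
Proof.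
  intros Hnu Hz eps He; set (c := Cmod (Cbin (RtoC 1 - z) k)).
  assert (Hc : 0 <= c) by apply Cmod_ge_0.
  destruct (exp_neg_ln_small nu (fst z + INR k - 1) (eps / (c + 1))) as [N HN];
    [easy|lra|apply Rdiv_lt_0_compat; lra|].
  exists N; intros n Hn; specialize (HN n Hn).
  assert (Hx : 0 < INR n + nu) by (generalize (pos_INR n); lra).
  set (x := INR n + nu) in *.
  replace (em_term k z x - RtoC 0)%C with (em_term k z x) by ring.
  unfold em_term; rewrite !Cmod_mult, Cmod_R, Cmod_Rpower_C; fold c.
  rewrite Rabs_pos_eq.
  2: apply Rmult_le_pos; [lra|left; now apply Rinv_0_lt_compat, pow_lt].
  replace (x * / x ^ k * (c * exp (fst (- z)%C * ln x))) with
    (c * exp (- (fst z + INR k - 1) * ln x)).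
  - assert (0 < exp (- (fst z + INR k - 1) * ln x)) by apply exp_pos.
    apply Rle_lt_trans with ((c + 1) * exp (- (fst z + INR k - 1) * ln x)); [nra|].
    apply (Rmult_lt_compat_l (c + 1)) in HN; [|lra].
    now replace ((c + 1) * (eps / (c + 1))) with eps in HN by (field; lra).
  - rewrite <- Rpower_pow by easy; unfold Rpower; rewrite <- exp_Ropp.
    rewrite <- (exp_ln x) at 2 by easy.
    transitivity (c * (exp (ln x) * exp (- (INR k * ln x)) * exp (fst (- z)%C * ln x))); [|ring].
    rewrite <- !exp_plus; do 2 f_equal; simpl; ring.
Qed.

Lemma em_sum_vanishes (m : nat) (z : C) (nu : R) :
  0 < nu -> 1 < fst z -> Clim (fun n => em_sum m z (INR n + nu)) (RtoC 0).
Proof.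
  intros Hnu Hz; apply (Clim_Csum_zero (fun n k => RtoC (bern k) * em_term k z (INR n + nu))%C).
  intros k; replace (RtoC 0) with (RtoC (bern k) * RtoC 0)%C by ring.
  apply Clim_scal, em_term_vanishes; [easy|generalize (pos_INR k); lra].
Qed.

Lemma em_error_partial_sum (m N : nat) (z : C) (nu : R) :
  Csum (fun n => em_error m z (INR n + nu)) N =
  ((z - RtoC 1) * Csum (fun n => Rpower_C (INR n + nu) (- z)) N
    - em_sum m z nu + em_sum m z (INR N + nu))%C.
Proof.
  induction N as [|N IH]; cbn [Csum]; [simpl; rewrite Rplus_0_l; ring|].
  rewrite IH, S_INR; unfold em_error.
  replace (INR N + 1 + nu) with (INR N + nu + 1) by ring; ring.
Qed.

(* [v] is the value at [z] of the entire function [(z - 1) zeta(z, nu)]. *)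
Definition is_em_value (nu : R) (z : C) (m : nat) (v : C) : Prop :=
  is_Cseries (fun n => em_error m z (INR n + nu)) (v - em_sum m z nu)%C.

(** The order [m] has to grow as [Re z] decreases, so no single series defines the function; the
    value is chosen over all admissible orders, which [is_em_value_add] shows to agree. *)
Definition zeta_num (nu : R) (z : C) : C :=
  epsilon (inhabits (RtoC 0))
    (fun v => exists m : nat, (2 <= m)%nat /\ 2 < fst z + INR m /\ is_em_value nu z m v).

Lemma is_em_value_ex (nu : R) (z : C) (m : nat) :
  0 < nu -> (2 <= m)%nat -> 2 < fst z + INR m -> exists v : C, is_em_value nu z m v.
Proof.
  intros Hnu Hm Hz.
  destruct (em_error_summable nu m z (fst z + INR m - 2)) as (d & M & S & Hd & HS); try lra; [easy|].
  destruct (is_Cseries_dominated (fun n => em_error m z (INR n + nu)) M S) as [l [Hl _]]; [|easy|].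
  - intros n; apply (disc_analytic_bound _ _ _ _ _ z (Hd n)), Cmod_center; lra.
  - exists (l + em_sum m z nu)%C; unfold is_em_value.
    now replace (l + em_sum m z nu - em_sum m z nu)%C with l by ring.
Qed.

Lemma is_em_value_unique (nu : R) (z v w : C) (m : nat) :
  is_em_value nu z m v -> is_em_value nu z m w -> v = w.
Proof.
  intros Hv Hw; assert (H := Clim_unique _ _ _ Hv Hw).
  replace v with ((v - em_sum m z nu) + em_sum m z nu)%C by ring; rewrite H; ring.
Qed.

(** By telescoping, raising the order from [m] to [m + 1] changes the [N]-th approximation only by
    the boundary term [B_m em_term m] at [N + nu], which tends to zero. *)
Lemma is_em_value_add (nu : R) (z v : C) (m k : nat) :
  0 < nu -> (2 <= m)%nat -> 2 < fst z + INR m -> is_em_value nu z m v ->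
  is_em_value nu z (m + k) v.
Proof.
  intros Hnu Hm Hz Hv; induction k as [|k IH]; [now rewrite Nat.add_0_r|].
  rewrite Nat.add_succ_r; assert (Hk := pos_INR k).
  destruct (is_em_value_ex nu z (S (m + k)) Hnu ltac:(lia)) as [w Hw].
  { rewrite S_INR, plus_INR; lra. }
  replace v with w; [easy|].
  assert (H : Clim (fun N => RtoC (bern (m + k)) * em_term (m + k) z nu +
    (Csum (fun n => em_error (S (m + k)) z (INR n + nu)) N -
     Csum (fun n => em_error (m + k) z (INR n + nu)) N))%C
    (RtoC (bern (m + k)) * em_term (m + k) z nu +
      ((w - em_sum (S (m + k)) z nu) - (v - em_sum (m + k) z nu)))%C).
  { apply (Clim_plus (fun _ => _)); [apply Clim_const|]; now apply Clim_minus. }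
  replace (RtoC (bern (m + k)) * em_term (m + k) z nu +
      ((w - em_sum (S (m + k)) z nu) - (v - em_sum (m + k) z nu)))%C with (w - v)%C in H
    by (unfold em_sum; cbn [Csum]; ring).
  assert (H0 : (w - v)%C = RtoC 0); [|now apply Ceq_minus].
  eapply Clim_unique; [exact H|].
  apply Clim_ext with (fun N => RtoC (bern (m + k)) * em_term (m + k) z (INR N + nu))%C.
  { intros N; rewrite !em_error_partial_sum; unfold em_sum; cbn [Csum]; ring. }
  replace (RtoC 0) with (RtoC (bern (m + k)) * RtoC 0)%C by ring.
  apply Clim_scal, em_term_vanishes; [easy|rewrite plus_INR; lra].
Qed.

Lemma is_em_value_zeta_num (nu : R) (z : C) (m : nat) :
  0 < nu -> (2 <= m)%nat -> 2 < fst z + INR m -> is_em_value nu z m (zeta_num nu z).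
Proof.
  intros Hnu Hm Hz; destruct (is_em_value_ex nu z m Hnu Hm Hz) as [v Hv].
  assert (H : exists m', (2 <= m')%nat /\ 2 < fst z + INR m' /\ is_em_value nu z m' (zeta_num nu z)).
  { unfold zeta_num; apply epsilon_spec; now exists v, m. }
  destruct H as (m' & Hm' & Hz' & H').
  apply (is_em_value_add nu z _ m m' Hnu Hm Hz) in Hv as Hv1.
  apply (is_em_value_add nu z _ m' m Hnu Hm' Hz') in H'.
  rewrite Nat.add_comm in H'.
  now rewrite (is_em_value_unique _ _ _ _ _ H' Hv1).
Qed.

Lemma disc_analytic_zeta_num (nu : R) (z0 : C) (r : R) (m : nat) :
  0 < nu -> (2 <= m)%nat -> 0 < r -> 2 < fst z0 - r + INR m ->
  exists (d : nat -> C) (D dT : C) (M : nat -> R) (MT S : R),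
    (forall n : nat, disc_analytic z0 r (fun z => em_error m z (INR n + nu)) (d n) (M n)) /\
    disc_analytic z0 r (fun z => em_sum m z nu) dT MT /\
    is_Cseries d D /\ disc_analytic z0 r (zeta_num nu) (dT + D)%C (MT + S).
Proof.
  intros Hnu Hm Hr Hz0.
  destruct (em_error_summable nu m z0 r Hnu Hm Hr ltac:(lra)) as (e & M & S & He & HS).
  destruct (disc_analytic_em_sum m z0 r nu (Rlt_le _ _ Hr) Hnu) as (dT & MT & HT).
  destruct (disc_analytic_series z0 r (fun n z => em_error m z (INR n + nu)) e M S
    (fun z => zeta_num nu z - em_sum m z nu)%C Hr He HS) as (D & HD & HpD).
  { intros z Hz; apply is_em_value_zeta_num; [easy|easy|].
    assert (Rabs (fst z - fst z0) <= r).
    { apply Rle_trans with (2 := Hz), (re_le_Cmod (z - z0)%C). }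
    apply Rabs_le_between in H; lra. }
  exists e, D, dT, M, MT, S; repeat split; try easy.
  eapply disc_analytic_ext; [|reflexivity|apply Rle_refl|apply (disc_analytic_plus _ _ _ _ _ _ _ _ (Rlt_le _ _ Hr) HT HpD)].
  intros z _; cbv beta; ring.
Qed.

Definition zeta_em (nu : R) (z : C) : C := (zeta_num nu z / (z - RtoC 1))%C.

Lemma zeta_em_continuation (nu : R) : 0 < nu -> is_hurwitz_continuation nu (zeta_em nu).
Proof.
  intros Hnu; split.
  - intros z0 Hz0.
    assert (Hz1 : 0 < Cmod (z0 - RtoC 1)%C).
    { apply Cmod_gt_0; intros E; apply Hz0; now apply Ceq_minus. }
    (* Half the distance to [1] keeps the pole off the disc for the division; the bound [1 / 2] lets
       the single order [p + 2] serve the whole disc. *)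
    set (r := Rmin (1 / 2) (Cmod (z0 - RtoC 1)%C / 2)).
    assert (Hr : 0 < r) by (apply Rmin_pos; lra).
    assert (Hr1 : r <= 1 / 2) by apply Rmin_l.
    assert (Hr2 : r <= Cmod (z0 - RtoC 1)%C / 2) by apply Rmin_r.
    destruct (nfloor_ex (Rabs (3 - fst z0)) (Rabs_pos _)) as [p [_ Hp]].
    destruct (disc_analytic_zeta_num nu z0 r (p + 2))
      as (d & D & dT & M & MT & S & _ & _ & _ & H); try easy; [lia| |].
    { rewrite plus_INR; change (INR 2) with 2; generalize (Rle_abs (3 - fst z0)); lra. }
    eapply disc_analytic_analytic_at; [exact Hr|].
    apply (fun Hlt => disc_analytic_div_lin _ _ (RtoC 1) _ _ _ Hlt H); lra.
  - intros z Hz; apply is_Cseries_is_series.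
    assert (Hz1 : (z - RtoC 1)%C <> RtoC 0).
    { intros E; apply Ceq_minus in E; rewrite E in Hz; simpl in Hz; lra. }
    assert (H := is_em_value_zeta_num nu z 2 Hnu (Nat.le_refl _) ltac:(simpl; lra)).
    unfold is_em_value, is_Cseries in H.
    (* For [Re z > 1] the boundary sum at [N + nu] vanishes in the limit, which leaves [z - 1] times
       the Dirichlet series. *)
    assert (H1 := Clim_minus _ _ _ _ (Clim_plus _ _ _ _ H (Clim_const (em_sum 2 z nu)))
      (em_sum_vanishes 2 z nu Hnu Hz)).
    apply (Clim_scal (/ (z - RtoC 1))%C) in H1.
    replace (zeta_em nu z) with
      (/ (z - RtoC 1) * (zeta_num nu z - em_sum 2 z nu + em_sum 2 z nu - RtoC 0))%C
      by (unfold zeta_em; now field).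
    eapply Clim_ext; [|exact H1]; intros N; cbv beta.
    rewrite em_error_partial_sum; now field.
Qed.

(** * The identity theorem *)

(** Strong induction: once the lower coefficients vanish, each zero [z] of [h] near [z0] forces
    [|a_k|] to be at most a constant times [|z - z0|], and such zeros exist arbitrarily close. *)
Lemma pseries_zeros_cluster (a : nat -> C) (h : C -> C) (z0 : C) (r : R) :
  0 < r ->
  (forall z : C, Cmod (z - z0)%C < r -> is_Cseries (fun k => a k * (z - z0) ^ k)%C (h z)) ->
  (forall eps : R, 0 < eps ->
     exists z : C, 0 < Cmod (z - z0)%C < eps /\ h z = RtoC 0) ->
  forall k : nat, a k = RtoC 0.
Proof.
  intros Hr Ha Hz.
  set (t := r / 2); assert (Ht : 0 < t) by (unfold t; lra).
  (* Terms of a convergent series are bounded: past [N] each is a difference of two partial sums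
     within [1] of the limit, hence the [2]. *)
  assert (HB : exists B, 0 <= B /\ forall k, Cmod (a k) * t ^ k <= B).
  { assert (Hc := Ha (z0 + RtoC t)%C).
    replace (z0 + RtoC t - z0)%C with (RtoC t) in Hc by ring.
    rewrite Cmod_R, Rabs_pos_eq in Hc by lra.
    specialize (Hc ltac:(unfold t; lra)).
    destruct (Hc 1 Rlt_0_1) as [N HN].
    exists (Rsum (fun k => Cmod (a k) * t ^ k) N + 2); split.
    { generalize (Rsum_nonneg (fun k => Cmod (a k) * t ^ k) N
        (fun k => Cmod_coef_ge_0 (a k) t k (Rlt_le _ _ Ht))); lra. }
    intros k; destruct (Nat.lt_ge_cases k N) as [Hk|Hk].
    - apply Rle_trans with (Rsum (fun k => Cmod (a k) * t ^ k) (S k)).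
      + simpl; generalize (Rsum_nonneg (fun k => Cmod (a k) * t ^ k) k
          (fun k => Cmod_coef_ge_0 (a k) t k (Rlt_le _ _ Ht))); lra.
      + generalize (Rsum_incr (fun k => Cmod (a k) * t ^ k) (S k) N
          (fun k => Cmod_coef_ge_0 (a k) t k (Rlt_le _ _ Ht)) Hk); lra.
    - assert (E : (a k * RtoC t ^ k)%C = ((Csum (fun k => a k * RtoC t ^ k) (S k) - h (z0 + RtoC t)) -
        (Csum (fun k => a k * RtoC t ^ k) k - h (z0 + RtoC t)))%C) by (cbn [Csum]; ring).
      apply (f_equal Cmod) in E; rewrite Cmod_mult, Cmod_pow, Cmod_R, Rabs_pos_eq in E by lra.
      rewrite E; eapply Rle_trans; [apply Cmod_triangle|]; rewrite Cmod_opp.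
      generalize (HN k Hk) (HN (S k) ltac:(lia))
        (Rsum_nonneg (fun k => Cmod (a k) * t ^ k) N
          (fun k => Cmod_coef_ge_0 (a k) t k (Rlt_le _ _ Ht))); lra. }
  destruct HB as (B & HB0 & HB).
  intros k; induction k as [k IH] using Wf_nat.lt_wf_ind.
  apply Cmod_eq_0, Rle_antisym; [|apply Cmod_ge_0]; apply Rle_plus_epsilon; intros e He.
  assert (Htk : 0 < t ^ k) by now apply pow_lt.
  destruct (Hz (Rmin (t / 2) (e * t ^ k * t / (2 * B + 1)))) as [z [[Hz1 Hz2] Hz3]].
  { apply Rmin_pos; [lra|]; apply Rdiv_lt_0_compat; [|lra].
    repeat apply Rmult_lt_0_compat; lra. }
  assert (Hzt : Cmod (z - z0)%C < t / 2) by (eapply Rlt_le_trans; [exact Hz2|apply Rmin_l]).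
  assert (Hze : Cmod (z - z0)%C < e * t ^ k * t / (2 * B + 1))
    by (eapply Rlt_le_trans; [exact Hz2|apply Rmin_r]).
  assert (Hs := Ha z ltac:(unfold t in *; lra)); rewrite Hz3 in Hs.
  set (w := (z - z0)%C) in *; set (s := Cmod w) in *.
  assert (Hw : (w ^ k)%C <> RtoC 0) by (apply Cpow_nz; now apply Cmod_gt_0).
  (* Divide by [w^k]: what remains after the constant term is [O(s)]. *)
  assert (Htail : is_Cseries (fun j => a (S k + j)%nat * w ^ (S j))%C (- a k)%C).
  { replace (RtoC 0) with (Csum (fun k => a k * w ^ k)%C (S k) + - (a k * w ^ k))%C in Hs.
    - apply (proj2 (is_Cseries_incr _ _ _)) in Hs.
      apply (is_Cseries_scal (/ w ^ k)%C) in Hs.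
      replace (- a k)%C with (/ w ^ k * - (a k * w ^ k))%C by now field.
      revert Hs; apply is_Cseries_ext; intros j.
      replace (S k + j)%nat with (k + S j)%nat by lia; rewrite Cpow_add_r; now field.
    - cbn [Csum]; rewrite (Csum_ext _ (fun _ => RtoC 0)), Csum_zero; [ring|].
      intros j Hj; rewrite IH by easy; ring. }
  assert (Hb : Cmod (- a k)%C <= B / t ^ k * (s / t) * 2).
  { refine (is_Cseries_norm_le _ (fun j => B / t ^ k * (s / t) * (/ 2) ^ j) _ _ _ _ Htail).
    - intros j; rewrite Cmod_mult, Cmod_pow; fold s.
      replace (Cmod (a (S k + j)%nat) * s ^ S j) with
        ((Cmod (a (S k + j)%nat) * t ^ (S k + j)) * (/ t ^ k * (s / t) * (s / t) ^ j)).
      + assert (Hst : 0 <= s / t <= / 2).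
        { split; [apply Rmult_le_pos; [lra|left; now apply Rinv_0_lt_compat]|].
          apply Rmult_le_reg_r with t; [easy|]; unfold Rdiv; rewrite Rmult_assoc, Rinv_l; lra. }
        assert (Hik : 0 < / t ^ k) by now apply Rinv_0_lt_compat.
        assert (Hit : 0 < / t) by now apply Rinv_0_lt_compat.
        replace (B / t ^ k * (s / t) * (/ 2) ^ j) with (B * (/ t ^ k * (s / t) * (/ 2) ^ j))
          by (unfold Rdiv; ring).
        apply Rmult_le_compat; [|repeat apply Rmult_le_pos; try lra; now apply pow_le|apply HB|].
        * apply Cmod_coef_ge_0; lra.
        * apply Rmult_le_compat_l; [apply Rmult_le_pos; lra|]; now apply pow_incr.
      + replace (S k + j)%nat with (k + S j)%nat by lia.
        unfold Rdiv; rewrite pow_add, Rpow_mult_distr, <- Rinv_pow by lra; cbn [pow]; field.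
        split; [apply pow_nonzero|]; lra.
    - intros n; rewrite Rsum_scal; apply Rmult_le_compat_l.
      + apply Rmult_le_pos; [apply Rmult_le_pos|apply Rmult_le_pos]; try lra;
          left; now apply Rinv_0_lt_compat.
      + assert (G : Rsum (fun j => (/ 2) ^ j) n = 2 - 2 * (/ 2) ^ n).
        { clear; induction n as [|n IH]; simpl; [lra|rewrite IH; lra]. }
        change (pow (/ 2)) with (fun j => (/ 2) ^ j).
        rewrite G; generalize (pow_le (/ 2) n ltac:(lra)); lra. }
  rewrite Cmod_opp in Hb; rewrite Rplus_0_l; apply Rle_trans with (1 := Hb).
  replace (B / t ^ k * (s / t) * 2) with (2 * B * s / (t ^ k * t)) by (field; split; lra).
  apply Rmult_le_reg_r with (t ^ k * t); [now apply Rmult_lt_0_compat|].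
  unfold Rdiv at 1; rewrite Rmult_assoc, Rinv_l, Rmult_1_r
    by (apply Rgt_not_eq; now apply Rmult_lt_0_compat).
  apply Rlt_le, Rle_lt_trans with ((2 * B + 1) * s); [nra|].
  apply (Rmult_lt_compat_l (2 * B + 1)) in Hze; [|lra].
  replace ((2 * B + 1) * (e * t ^ k * t / (2 * B + 1))) with (e * (t ^ k * t)) in Hze
    by (field; lra).
  exact Hze.
Qed.

Definition eq_near (f g : C -> C) (z0 : C) : Prop :=
  exists r : R, 0 < r /\ forall z : C, Cmod (z - z0)%C < r -> f z = g z.

Lemma analytic_eq_near (f g : C -> C) (z0 : C) :
  analytic_at f z0 -> analytic_at g z0 ->
  (forall eps : R, 0 < eps -> exists z : C, 0 < Cmod (z - z0)%C < eps /\ f z = g z) ->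
  eq_near f g z0.
Proof.
  intros (a & r & Hr & Ha) (b & s & Hs & Hb) H.
  assert (Hrs : 0 < Rmin r s) by now apply Rmin_pos.
  assert (Hd : forall z, Cmod (z - z0)%C < Rmin r s ->
    is_Cseries (fun k => (a k - b k) * (z - z0) ^ k)%C (f z - g z)%C).
  { intros z Hz.
    assert (H1 := proj2 (is_Cseries_is_series _ _) (Ha z (Rlt_le_trans _ _ _ Hz (Rmin_l _ _)))).
    assert (H2 := proj2 (is_Cseries_is_series _ _) (Hb z (Rlt_le_trans _ _ _ Hz (Rmin_r _ _)))).
    eapply is_Cseries_ext; [|exact (is_Cseries_minus _ _ _ _ H1 H2)].
    intros k; simpl; rewrite !pow_n_Cpow; unfold scal; simpl; unfold mult; simpl; ring. }
  exists (Rmin r s); split; [easy|]; intros z Hz; apply Ceq_minus.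
  eapply Clim_unique; [exact (Hd z Hz)|].
  apply (is_Cseries_finite_eq _ 0); [|easy]; intros k _.
  rewrite (pseries_zeros_cluster (fun k => a k - b k)%C (fun z => f z - g z)%C z0 (Rmin r s));
    [ring|easy|easy|].
  intros e He; destruct (H e He) as (y & Hy & E); exists y; split; [easy|].
  rewrite E; ring.
Qed.

(** Connectedness of the segment: let [T] be the supremum of the parameters up to which [f] and [g]
    agree locally. Agreement points cluster at [p T], so they agree near [p T], hence beyond it
    unless [T = 1]. *)
Lemma analytic_eq_near_segment (f g : C -> C) (u v : C) :
  u <> v ->
  (forall t : R, 0 <= t <= 1 ->
     analytic_at f (u + RtoC t * (v - u))%C /\ analytic_at g (u + RtoC t * (v - u))%C) ->
  eq_near f g u -> eq_near f g v.
Proof.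
  intros Huv Hfg Hu.
  set (p := fun t : R => (u + RtoC t * (v - u))%C).
  set (L := Cmod (v - u)%C).
  assert (HL : 0 < L).
  { apply Cmod_gt_0; intros E; apply Huv; symmetry; now apply Ceq_minus. }
  assert (Hdist : forall s t, Cmod (p s - p t)%C = Rabs (s - t) * L).
  { intros s t; unfold p, L; rewrite <- Cmod_R, <- Cmod_mult; f_equal; rewrite RtoC_minus; ring. }
  set (E := fun t => 0 <= t <= 1 /\ forall s, 0 <= s <= t -> eq_near f g (p s)).
  assert (Hp0 : p 0 = u) by (unfold p; ring).
  assert (HE0 : E 0).
  { split; [lra|]; intros s Hs; replace s with 0 by lra; now rewrite Hp0. }
  destruct (completeness E) as [T [HT1 HT2]].
  { exists 1; intros t [Ht _]; lra. }
  { now exists 0. }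
  assert (HT0 : 0 <= T) by now apply HT1.
  assert (HT : T <= 1) by (apply HT2; intros t [Ht _]; lra).
  assert (Hbelow : forall s, 0 <= s < T -> eq_near f g (p s)).
  { intros s Hs; apply Classical_Prop.NNPP; intros Hn.
    assert (T <= s); [|lra].
    apply HT2; intros t [Ht1 Ht2]; apply Rnot_lt_le; intros Hlt; apply Hn, Ht2; lra. }
  assert (HeqT : eq_near f g (p T)).
  { destruct (Req_dec T 0) as [->|Hne]; [now rewrite Hp0|].
    apply analytic_eq_near; try (apply Hfg; lra).
    (* [T / 2] keeps [s] nonnegative; the other bound places [p s] within [e / 2] of [p T]. *)
    intros e He; set (s := Rmax (T / 2) (T - e / (2 * L))).
    assert (Hs1 : T / 2 <= s) by apply Rmax_l.
    assert (Hs2 : T - e / (2 * L) <= s) by apply Rmax_r.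
    assert (He2 : 0 < e / (2 * L)) by (apply Rdiv_lt_0_compat; lra).
    assert (Hs3 : s < T) by (apply Rmax_lub_lt; lra).
    exists (p s); split.
    - rewrite Hdist, Rabs_left by lra; split; [nra|].
      apply Rle_lt_trans with (e / (2 * L) * L); [apply Rmult_le_compat_r; lra|].
      replace (e / (2 * L) * L) with (e / 2) by (field; lra); lra.
    - destruct (Hbelow s) as [r [Hr H]]; [lra|]; apply H.
      rewrite Hdist, Rminus_diag, Rabs_R0; lra. }
  replace v with (p 1) by (unfold p; ring).
  destruct (Req_dec T 1) as [->|HT1']; [easy|exfalso].
  destruct HeqT as [r [Hr H]].
  set (h := Rmin (1 - T) (r / (2 * L))).
  assert (Hr2 : 0 < r / (2 * L)) by (apply Rdiv_lt_0_compat; lra).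
  assert (Hh : 0 < h) by (apply Rmin_pos; lra).
  assert (Hh1 : h <= 1 - T) by apply Rmin_l.
  assert (Hh2 : h <= r / (2 * L)) by apply Rmin_r.
  assert (HEh : E (T + h)); [|apply HT1 in HEh; lra].
  split; [lra|]; intros s Hs.
  destruct (Rlt_le_dec s T) as [Hlt|Hge]; [apply Hbelow; lra|].
  exists (r / 2); split; [lra|]; intros z Hz; apply H.
  replace (z - p T)%C with ((z - p s) + (p s - p T))%C by ring.
  eapply Rle_lt_trans; [apply Cmod_triangle|].
  rewrite Hdist, Rabs_pos_eq by lra.
  assert ((s - T) * L <= r / 2); [|lra].
  apply Rle_trans with (r / (2 * L) * L); [apply Rmult_le_compat_r; lra|].
  right; field; lra.
Qed.

(** The existence of [f] makes [epsilon] return a genuine continuation. Both are given by the same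
    Dirichlet series around [2 + i], and the agreement is carried to [-1]. *)
Lemma hurwitz_zeta_eq_near (nu : R) (f : C -> C) :
  is_hurwitz_continuation nu f ->
  eq_near (fun w => hurwitz_zeta w nu) f (RtoC (-1)).
Proof.
  intros Hf.
  assert (Hz : is_hurwitz_continuation nu (fun w => hurwitz_zeta w nu)).
  { unfold hurwitz_zeta.
    change (is_hurwitz_continuation nu
      (epsilon (inhabits (fun _ : C => RtoC 0)) (is_hurwitz_continuation nu))).
    apply epsilon_spec; now exists f. }
  destruct Hf as [Hf1 Hf2], Hz as [Hz1 Hz2].
  (* The segment from [2 + i] to [-1] avoids the pole. *)
  apply (analytic_eq_near_segment _ _ (2, 1)).
  - intros E; apply (f_equal snd) in E; simpl in E; lra.
  - intros t Ht.
    assert (Hne : ((2, 1) + RtoC t * (RtoC (-1) - (2, 1)))%C <> RtoC 1).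
    { intros E; generalize (f_equal fst E) (f_equal snd E); simpl; lra. }
    now split; [apply Hz1|apply Hf1].
  - exists 1; split; [lra|]; intros z Hzr.
    assert (Hre : 1 < fst z).
    { assert (Hb : Rabs (fst z - 2) < 1).
      { eapply Rle_lt_trans; [|exact Hzr]; apply (re_le_Cmod (z - (2, 1))%C). }
      apply Rabs_lt_between in Hb; lra. }
    eapply Clim_unique; apply is_Cseries_is_series; [apply Hz2|apply Hf2]; easy.
Qed.

Lemma disc_analytic_derivative_unique (z0 : C) (r : R) (f : C -> C) (d e : C) (M N : R) :
  0 < r -> disc_analytic z0 r f d M -> disc_analytic z0 r f e N -> d = e.
Proof.
  intros Hr Hd He; apply (disc_analytic_is_derive _ _ _ _ _ Hr) in Hd, He.
  now rewrite <- (is_C_derive_unique _ _ _ Hd), <- (is_C_derive_unique _ _ _ He).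
Qed.

(** * Order four at [-1] *)

(** The derivative of [em_sum 4 z x] in [z] at [-1]; with [B_2(x) = x^2 - x + 1/6] it is
    [- B_2(x) ln x + x/2 - 1/4]. *)
Definition em_sum4_deriv (x : R) : R :=
  - (x ^ 2 * ln x) + x / 2 + x * ln x - 1 / 4 - ln x / 6.

Definition em_error4_deriv (x : R) : R :=
  x + 2 * x * ln x - em_sum4_deriv x + em_sum4_deriv (x + 1).

Lemma Rpower_C_opp_m1 (x : R) : 0 < x -> Rpower_C x (- RtoC (-1))%C = RtoC x.
Proof.
  intros Hx; rewrite <- RtoC_opp, Rpower_C_RtoC; f_equal.
  replace (- -1 * ln x) with (ln x) by ring; now apply exp_ln.
Qed.

(** Writing the polynomial factors as nested linear ones lets [disc_analytic_mul_lin] produce the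
    derivative. *)
Lemma em_sum4_eq (z : C) (x : R) :
  0 < x -> em_sum 4 z x = (RtoC x * Rpower_C x (- z)
    + (RtoC (1 / 2) * ((z - RtoC 1) * Rpower_C x (- z))
    + RtoC (1 / 12 * / x) * ((z - RtoC 0) * ((z - RtoC 1) * Rpower_C x (- z)))))%C.
Proof.
  intros Hx; unfold em_sum; cbn [Csum]; rewrite bern_0, bern_1, bern_2, bern_3, Cmult_0_l.
  unfold em_term, Cbin; cbn [ode_coef].
  replace (x * / x ^ 0) with x by (simpl; field).
  replace (x * / x ^ 1) with 1 by (simpl; field; lra).
  replace (x * / x ^ 2) with (/ x) by (simpl; field; lra).
  change (INR 0) with 0; change (INR 1) with 1; change (INR 2) with 2.
  rewrite !Rmult_1_l, !RtoC_mult, RtoC_opp, !RtoC_div, RtoC_inv by lra.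
  field; repeat split; intros E; apply RtoC_inj in E; lra.
Qed.

Lemma em_sum4_at_m1 (x : R) : 0 < x -> em_sum 4 (RtoC (-1)) x = RtoC (x ^ 2 - x + 1 / 6).
Proof.
  intros Hx; rewrite em_sum4_eq, Rpower_C_opp_m1 by easy.
  rewrite <- ?RtoC_minus, <- ?RtoC_mult, <- ?RtoC_plus, <- ?RtoC_mult, <- ?RtoC_plus; f_equal.
  field; lra.
Qed.

(** [em_sum 4] at [-1] is [B_2(x)], and [B_2(x+1) - B_2(x) = 2 x]. Hence [zeta_num] at [-1] is
    exactly [B_2(nu)]. *)
Lemma em_error4_at_m1 (x : R) : 0 < x -> em_error 4 (RtoC (-1)) x = RtoC 0.
Proof.
  intros Hx; unfold em_error; rewrite !em_sum4_at_m1, Rpower_C_opp_m1 by lra.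
  rewrite <- ?RtoC_minus, <- ?RtoC_mult, <- ?RtoC_minus, <- ?RtoC_plus; f_equal.
  field; lra.
Qed.

Lemma disc_analytic_em_sum4 (r x : R) :
  0 <= r -> 0 < x ->
  exists M : R, disc_analytic (RtoC (-1)) r (fun z => em_sum 4 z x) (RtoC (em_sum4_deriv x)) M.
Proof.
  intros Hr Hx.
  assert (H0 := disc_analytic_Rpower_C (RtoC (-1)) r x Hr).
  assert (H1 := disc_analytic_mul_lin _ _ (RtoC 1) _ _ _ Hr H0).
  assert (H2 := disc_analytic_mul_lin _ _ (RtoC 0) _ _ _ Hr H1).
  eexists; eapply disc_analytic_ext; [| |apply Rle_refl|
    apply (disc_analytic_plus _ _ _ _ _ _ _ _ Hr (disc_analytic_scal _ _ (RtoC x) _ _ _ Hr H0)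
      (disc_analytic_plus _ _ _ _ _ _ _ _ Hr (disc_analytic_scal _ _ (RtoC (1 / 2)) _ _ _ Hr H1)
        (disc_analytic_scal _ _ (RtoC (1 / 12 * / x)) _ _ _ Hr H2)))].
  - intros z _; now rewrite em_sum4_eq.
  - cbv beta; rewrite Rpower_C_opp_m1 by easy.
    repeat rewrite <- ?RtoC_minus, <- ?RtoC_mult, <- ?RtoC_opp, <- ?RtoC_plus; f_equal.
    unfold em_sum4_deriv; field; lra.
Qed.

Lemma disc_analytic_em_error4 (r x : R) :
  0 <= r -> 0 < x ->
  exists M : R, disc_analytic (RtoC (-1)) r (fun z => em_error 4 z x) (RtoC (em_error4_deriv x)) M.
Proof.
  intros Hr Hx.
  destruct (disc_analytic_em_sum4 r x Hr Hx) as [M1 H1].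
  destruct (disc_analytic_em_sum4 r (x + 1) Hr ltac:(lra)) as [M2 H2].
  eexists; eapply disc_analytic_ext; [| |apply Rle_refl|
    apply (disc_analytic_plus _ _ _ _ _ _ _ _ Hr (disc_analytic_plus _ _ _ _ _ _ _ _ Hr
      (disc_analytic_mul_lin _ _ (RtoC 1) _ _ _ Hr (disc_analytic_Rpower_C (RtoC (-1)) r x Hr))
      (disc_analytic_scal _ _ (RtoC (-1)) _ _ _ Hr H1)) H2)].
  - intros z _; unfold em_error; cbv beta; ring.
  - cbv beta; rewrite Rpower_C_opp_m1 by easy.
    repeat rewrite <- ?RtoC_minus, <- ?RtoC_mult, <- ?RtoC_opp, <- ?RtoC_plus; f_equal.
    unfold em_error4_deriv; ring.
Qed.

Lemma Clim_RtoC (u : nat -> R) (l : C) : Clim (fun n => RtoC (u n)) l -> l = RtoC (fst l).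
Proof.
  intros H; apply C_ext; [easy|]; simpl; apply Rabs_eq_0, Rle_antisym; [|apply Rabs_pos].
  apply Rle_plus_epsilon; intros e He; destruct (H e He) as [N HN].
  specialize (HN N (Nat.le_refl _)).
  assert (Hm := Rle_trans _ _ _ (Rmax_r _ _) (Rmax_Cmod (RtoC (u N) - l)%C)).
  simpl in Hm; rewrite Rplus_0_l, Rabs_Ropp in Hm; lra.
Qed.

Lemma Csum_RtoC (u : nat -> R) (n : nat) : Csum (fun k => RtoC (u k)) n = RtoC (Rsum u n).
Proof. induction n as [|n IH]; simpl; [easy|]; now rewrite IH, RtoC_plus. Qed.

(** With [W = (z-1) zeta], the quotient rule gives [(W' - W / (z-1)) / (z-1)], which at [z = -1] is
    [- W' / 2 - W / 4]; here [W' = em_sum4_deriv nu + s] and [W = B_2(nu)]. *)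
Lemma hurwitz_zeta_deriv_m1 (nu : R) :
  0 < nu ->
  exists s : R, is_lim_seq (Rsum (fun n => em_error4_deriv (INR n + nu))) s /\
    is_hurwitz_zeta_deriv (RtoC (-1)) nu
      (RtoC (- (em_sum4_deriv nu + s) / 2 - (nu ^ 2 - nu + 1 / 6) / 4)).
Proof.
  intros Hnu; assert (Hr : 0 < 1 / 2) by lra.
  (* On the disc of radius [1 / 2] the condition reads [m > 7 / 2], so [4] is the least order. *)
  assert (Hm4 : 2 < fst (RtoC (-1)) - 1 / 2 + INR 4) by (simpl; lra).
  destruct (disc_analytic_zeta_num nu (RtoC (-1)) (1 / 2) 4 Hnu ltac:(lia) Hr Hm4)
    as (d & D & dT & M & MT & S & Hd & HT & HD & HW).
  assert (Hpos : forall n, 0 < INR n + nu) by (intros n; generalize (pos_INR n); lra).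
  assert (Ed : forall n, d n = RtoC (em_error4_deriv (INR n + nu))).
  { intros n; destruct (disc_analytic_em_error4 (1 / 2) (INR n + nu) (Rlt_le _ _ Hr) (Hpos n)) as [M' H'].
    exact (disc_analytic_derivative_unique _ _ _ _ _ _ _ Hr (Hd n) H'). }
  assert (EdT : dT = RtoC (em_sum4_deriv nu)).
  { destruct (disc_analytic_em_sum4 (1 / 2) nu (Rlt_le _ _ Hr) Hnu) as [M' H'].
    exact (disc_analytic_derivative_unique _ _ _ _ _ _ _ Hr HT H'). }
  assert (HDs : Clim (fun n => RtoC (Rsum (fun n => em_error4_deriv (INR n + nu)) n)) D).
  { revert HD; apply Clim_ext; intros n; rewrite <- Csum_RtoC; apply Csum_ext; intros; apply Ed. }
  assert (ED := Clim_RtoC _ _ HDs); set (s := fst D) in *.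
  assert (EW : zeta_num nu (RtoC (-1)) = RtoC (nu ^ 2 - nu + 1 / 6)).
  { assert (H := is_em_value_zeta_num nu (RtoC (-1)) 4 Hnu ltac:(lia) ltac:(simpl; lra)).
    rewrite <- em_sum4_at_m1 by easy; apply Ceq_minus.
    eapply Clim_unique; [exact H|].
    apply (is_Cseries_finite_eq _ 0); [|easy]; intros k _; now apply em_error4_at_m1. }
  exists s; split.
  - apply is_lim_seq_spec; intros eps; rewrite ED in HDs.
    destruct (HDs eps (cond_pos eps)) as [N HN]; exists N; intros n Hn.
    specialize (HN n Hn); now rewrite <- RtoC_minus, Cmod_R in HN.
  - destruct (hurwitz_zeta_eq_near nu _ (zeta_em_continuation nu Hnu)) as [r [Hr' Heq]].
    assert (Hc : Cmod (RtoC (-1) - RtoC 1)%C = 2).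
    { rewrite <- RtoC_minus, Cmod_R, Rabs_left; lra. }
    assert (Hlt : 0 <= 1 / 2 < Cmod (RtoC (-1) - RtoC 1)%C) by (rewrite Hc; lra).
    assert (HW' := disc_analytic_div_lin _ _ (RtoC 1) _ _ _ Hlt HW).
    apply (disc_analytic_is_derive _ _ _ _ _ Hr) in HW'.
    unfold is_hurwitz_zeta_deriv.
    apply (is_derive_ext_loc (K := C_AbsRing) (V := C_NormedModule) (zeta_em nu)).
    + exists (mkposreal r Hr'); intros z Hz; symmetry; apply Heq; exact Hz.
    + replace (RtoC (- (em_sum4_deriv nu + s) / 2 - (nu ^ 2 - nu + 1 / 6) / 4)) with
        ((dT + D - zeta_num nu (RtoC (-1)) / (RtoC (-1) - RtoC 1)) / (RtoC (-1) - RtoC 1))%C;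
        [exact HW'|].
      rewrite EW, EdT, ED.
      repeat rewrite <- ?RtoC_minus, <- ?RtoC_plus, <- ?RtoC_div by lra; f_equal; field.
Qed.

(** * The Laplace transform of the third Bernoulli polynomial *)

Definition bernoulli_poly3 (s : R) : R := s ^ 3 - 3 / 2 * s ^ 2 + s / 2.

Lemma bernoulli_poly3_bound (s : R) : 0 <= s <= 1 -> Rabs (bernoulli_poly3 s) <= 1.
Proof.
  intros Hs; unfold bernoulli_poly3; apply Rabs_le.
  assert (0 <= s ^ 2 <= 1) by (simpl; nra).
  assert (0 <= s ^ 3 <= 1) by (simpl in *; nra).
  simpl in *; nra.
Qed.

Definition bernoulli_poly3_laplace (u : R) : R := RInt (fun s => bernoulli_poly3 s * exp (- (u * s))) 0 1.

Lemma is_RInt_value (f : R -> R) (a b l : R) : is_RInt f a b l -> RInt f a b = l.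
Proof. apply (is_RInt_unique (V := R_CompleteNormedModule)). Qed.

Lemma ex_RInt_derivable (f : R -> R) (a b : R) :
  (forall t : R, Rmin a b <= t <= Rmax a b -> ex_derive f t) -> ex_RInt f a b.
Proof.
  intros H; apply (ex_RInt_continuous (V := R_CompleteNormedModule)); intros t Ht.
  now apply (ex_derive_continuous (V := R_NormedModule)), H.
Qed.

(** Repeated integration by parts: [Q] collects [B_3], [B_3'], [B_3''] and [B_3''' = 6] over
    successive powers of [u]. *)
Lemma bernoulli_poly3_laplace_eq (u : R) :
  0 < u ->
  1 - (1 - exp (- u)) * (1 / u + 1 / 2 + u / 12) = - (1 / 6) * u ^ 3 * bernoulli_poly3_laplace u.
Proof.
  intros Hu; unfold bernoulli_poly3_laplace.
  set (Q := fun s => - (bernoulli_poly3 s / u + (3 * s ^ 2 - 3 * s + 1 / 2) / u ^ 2 + (6 * s - 3) / u ^ 3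
    + 6 / u ^ 4) * exp (- (u * s))).
  assert (H : is_RInt (fun s => bernoulli_poly3 s * exp (- (u * s))) 0 1 (Q 1 - Q 0)).
  { apply (is_RInt_derive (V := R_CompleteNormedModule) Q); intros s _.
    - unfold Q, bernoulli_poly3; auto_derive; [lra|field; lra].
    - apply (ex_derive_continuous (V := R_NormedModule)); unfold bernoulli_poly3; auto_derive; easy. }
  apply is_RInt_value in H; rewrite H; unfold Q, bernoulli_poly3.
  rewrite (Rmult_1_r u), (Rmult_0_r u), Ropp_0, exp_0; field; lra.
Qed.

Lemma RInt_abs_le_const (f : R -> R) (M : R) :
  ex_RInt f 0 1 -> (forall s : R, 0 <= s <= 1 -> Rabs (f s) <= M) -> Rabs (RInt f 0 1) <= M.
Proof.
  intros Hf H; replace M with ((1 - 0) * M) by ring.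
  apply (norm_RInt_le_const (V := R_NormedModule) f 0 1); [lra|exact H|].
  now apply (RInt_correct (V := R_CompleteNormedModule)).
Qed.

Lemma bernoulli_poly3_laplace_bound (u : R) : 0 < u -> Rabs (bernoulli_poly3_laplace u) <= 1.
Proof.
  intros Hu; apply RInt_abs_le_const.
  - apply ex_RInt_derivable; intros s _; unfold bernoulli_poly3; auto_derive; easy.
  - intros s Hs; rewrite Rabs_mult, (Rabs_pos_eq (exp _)) by (left; apply exp_pos).
    assert (exp (- (u * s)) <= 1) by (rewrite <- exp_0; apply exp_le_compat; nra).
    generalize (bernoulli_poly3_bound s Hs) (Rabs_pos (bernoulli_poly3 s)) (exp_pos (- (u * s))); nra.
Qed.

(* [gamma_part y t] is the integral of [u exp (-y u)] over [0, t]. *)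
Definition gamma_part (y t : R) : R := (1 - (1 + y * t) * exp (- (y * t))) / y ^ 2.

Lemma gamma_part_small (y t : R) : 0 < y -> 0 <= t -> Rabs (gamma_part y t) <= t ^ 2.
Proof.
  intros Hy Ht; unfold gamma_part; set (w := y * t).
  assert (Hw : 0 <= w) by now apply Rmult_le_pos; lra.
  assert (H1 : 1 + - w <= exp (- w)) by apply exp_ineq1_le.
  assert (H2 : (1 + w) * exp (- w) <= 1).
  { replace 1 with (exp w * exp (- w)) at 2 by (rewrite <- exp_plus, <- exp_0; f_equal; ring).
    apply Rmult_le_compat_r; [left; apply exp_pos|apply exp_ineq1_le]. }
  assert (Hy2 : 0 < y ^ 2) by now apply pow_lt.
  rewrite Rabs_pos_eq.
  - apply Rmult_le_reg_r with (y ^ 2); [easy|]; unfold Rdiv; rewrite Rmult_assoc, Rinv_l, Rmult_1_r by lra.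
    replace (t ^ 2 * y ^ 2) with (w ^ 2) by (unfold w; ring); nra.
  - apply Rmult_le_pos; [lra|left; now apply Rinv_0_lt_compat].
Qed.

Lemma gamma_part_large (x y t : R) :
  0 < x <= y -> 0 < t -> Rabs (gamma_part y t - / y ^ 2) <= 4 / (x ^ 3 * t).
Proof.
  intros Hy Ht; unfold gamma_part; set (w := y * t).
  assert (Hw : 0 < w) by (apply Rmult_lt_0_compat; lra).
  (* From [exp w >= (1 + w/2)^2], and [w (1 + w) <= 4 (1 + w/2)^2]. *)
  assert (H1 : (1 + w) * exp (- w) <= 4 / w).
  { assert (H : 1 + w / 2 <= exp (w / 2)) by apply exp_ineq1_le.
    assert (He : exp (- w) * (exp (w / 2) * exp (w / 2)) = 1).
    { rewrite <- !exp_plus, <- exp_0; f_equal; lra. }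
    assert (Hp := exp_pos (- w)).
    assert (Hq : exp (- w) * ((1 + w / 2) * (1 + w / 2)) <= 1).
    { rewrite <- He; apply Rmult_le_compat_l; [lra|]; nra. }
    apply Rmult_le_reg_r with w; [easy|]; replace (4 / w * w) with 4 by (field; lra); nra. }
  replace ((1 - (1 + w) * exp (- w)) / y ^ 2 - / y ^ 2) with (- ((1 + w) * exp (- w) / y ^ 2))
    by (field; lra).
  rewrite Rabs_Ropp, Rabs_pos_eq.
  - apply Rle_trans with (4 / w / y ^ 2).
    + apply Rmult_le_compat_r; [left; apply Rinv_0_lt_compat, pow_lt; lra|easy].
    + replace (4 / w / y ^ 2) with (4 * / (y ^ 3 * t)) by (unfold w; field; lra).
      apply Rmult_le_compat_l; [lra|].
      apply Rinv_le_contravar; [apply Rmult_lt_0_compat; [apply pow_lt|]; lra|].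
      apply Rmult_le_compat_r; [lra|]; apply pow_incr; lra.
  - apply Rmult_le_pos; [|left; apply Rinv_0_lt_compat, pow_lt; lra].
    apply Rmult_le_pos; [lra|left; apply exp_pos].
Qed.

Lemma gamma_part_derive (y t : R) :
  y <> 0 -> is_derive (gamma_part y) t (t * exp (- (y * t))).
Proof. intros Hy; unfold gamma_part; auto_derive; [easy|field; easy]. Qed.

(** The integral over [[0, t]] of [1/6 u exp (-x u)] times the Laplace transform of [B_3], with the
    [u]-integral done first. The remaining integral is over the fixed interval [[0, 1]], so its
    limits in [t] follow from bounds on the integrand. *)
Definition em_primitive (x t : R) : R :=
  1 / 6 * RInt (fun s => bernoulli_poly3 s * gamma_part (x + s) t) 0 1.

Lemma ex_RInt_em_primitive (x t : R) :
  0 < x -> ex_RInt (fun s => bernoulli_poly3 s * gamma_part (x + s) t) 0 1.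
Proof.
  intros Hx; apply ex_RInt_derivable; intros s Hs.
  rewrite Rmin_left, Rmax_right in Hs by lra.
  unfold bernoulli_poly3, gamma_part; auto_derive; repeat split; nra.
Qed.

Lemma continuity_2d_pt_exp_term (x u v : R) :
  continuity_2d_pt (fun u v => bernoulli_poly3 v * (u * exp (- ((x + v) * u)))) u v.
Proof.
  apply continuity_2d_pt_mult.
  - apply (continuity_1d_2d_pt_comp bernoulli_poly3 (fun u v => v)); [|apply continuity_2d_pt_id2].
    unfold bernoulli_poly3; apply derivable_continuous_pt; reg.
  - apply continuity_2d_pt_mult; [apply continuity_2d_pt_id1|].
    apply (continuity_1d_2d_pt_comp exp (fun u v => - ((x + v) * u))).
    + apply derivable_continuous_pt; reg.
    + apply continuity_2d_pt_opp, continuity_2d_pt_mult; [|apply continuity_2d_pt_id1].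
      apply continuity_2d_pt_plus; [apply continuity_2d_pt_const|apply continuity_2d_pt_id2].
Qed.

Lemma em_primitive_derive (x t : R) :
  0 < x -> is_derive (em_primitive x) t (1 / 6 * (exp (- (x * t)) * t * bernoulli_poly3_laplace t)).
Proof.
  intros Hx; unfold em_primitive.
  apply (is_derive_scal (fun t => RInt (fun s => bernoulli_poly3 s * gamma_part (x + s) t) 0 1)).
  assert (HD : forall u s, 0 < x + s -> is_derive (fun u => bernoulli_poly3 s * gamma_part (x + s) u) u
    (bernoulli_poly3 s * (u * exp (- ((x + s) * u))))).
  { intros u s Hs; apply (is_derive_scal (gamma_part (x + s))), gamma_part_derive; lra. }
  replace (exp (- (x * t)) * t * bernoulli_poly3_laplace t) with
    (RInt (fun s => Derive (fun u => bernoulli_poly3 s * gamma_part (x + s) u) t) 0 1).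
  - apply (is_derive_RInt_param (fun u s => bernoulli_poly3 s * gamma_part (x + s) u) 0 1 t).
    + exists (mkposreal 1 Rlt_0_1); intros u _ s Hs; rewrite Rmin_left in Hs by lra.
      eexists; apply HD; lra.
    + intros s Hs; rewrite Rmin_left in Hs by lra.
      apply (continuity_2d_pt_ext_loc (fun u v => bernoulli_poly3 v * (u * exp (- ((x + v) * u)))));
        [|apply continuity_2d_pt_exp_term].
      (* [s >= 0] and [|v - s| < x] keep [x + v] positive. *)
      exists (mkposreal x Hx); intros u v _ Hv; simpl in Hv; symmetry; apply is_derive_unique, HD.
      apply Rabs_lt_between in Hv; lra.
    + exists (mkposreal 1 Rlt_0_1); intros u _; now apply ex_RInt_em_primitive.
  - rewrite (RInt_ext _ (fun s => scal (exp (- (x * t)) * t) (bernoulli_poly3 s * exp (- (t * s))))).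
    + apply (RInt_scal (V := R_CompleteNormedModule)).
      apply ex_RInt_derivable; intros s _; unfold bernoulli_poly3; auto_derive; easy.
    + intros s Hs; rewrite Rmin_left in Hs by lra.
      replace (Derive (fun u => bernoulli_poly3 s * gamma_part (x + s) u) t) with
        (bernoulli_poly3 s * (t * exp (- ((x + s) * t)))) by (symmetry; apply is_derive_unique, HD; lra).
      replace (- ((x + s) * t)) with (- (x * t) + - (t * s)) by ring.
      rewrite exp_plus; unfold scal; simpl; unfold mult; simpl; ring.
Qed.

Lemma em_primitive_small (x t : R) :
  0 < x -> 0 <= t -> Rabs (em_primitive x t) <= t ^ 2.
Proof.
  intros Hx Ht; unfold em_primitive; rewrite Rabs_mult, (Rabs_pos_eq (1 / 6)) by lra.
  assert (H : Rabs (RInt (fun s => bernoulli_poly3 s * gamma_part (x + s) t) 0 1) <= t ^ 2).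
  { apply RInt_abs_le_const; [now apply ex_RInt_em_primitive|]; intros s Hs; rewrite Rabs_mult.
    generalize (bernoulli_poly3_bound s Hs) (gamma_part_small (x + s) t ltac:(lra) Ht)
      (Rabs_pos (bernoulli_poly3 s)) (Rabs_pos (gamma_part (x + s) t)); nra. }
  generalize (Rabs_pos (RInt (fun s => bernoulli_poly3 s * gamma_part (x + s) t) 0 1)); lra.
Qed.

(** The bridge between the two sides: the limits of the telescoped integrals are multiples of the
    terms in the series for the zeta derivative. [Q] arises by expanding [B_3(s)] in powers of
    [x + s] and integrating after division by [(x + s)^2]. *)
Lemma RInt_bernoulli_poly3_inv_sq (x : R) :
  0 < x ->
  is_RInt (fun s => bernoulli_poly3 s * / (x + s) ^ 2) 0 1 (-3 * em_error4_deriv x).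
Proof.
  intros Hx.
  set (Q := fun s => (x + s) ^ 2 / 2 - (3 * x + 3 / 2) * (x + s)
    + (3 * x ^ 2 + 3 * x + 1 / 2) * ln (x + s) + (x ^ 3 + 3 / 2 * x ^ 2 + x / 2) / (x + s)).
  replace (-3 * em_error4_deriv x) with (Q 1 - Q 0).
  - apply (is_RInt_derive (V := R_CompleteNormedModule) Q); intros s Hs;
      rewrite Rmin_left, Rmax_right in Hs by lra.
    + unfold Q, bernoulli_poly3; auto_derive; [repeat split; lra|field; lra].
    + apply (ex_derive_continuous (V := R_NormedModule)); unfold bernoulli_poly3; auto_derive.
      repeat split; nra.
  - unfold Q, em_error4_deriv, em_sum4_deriv; rewrite Rplus_0_r; field; lra.
Qed.

Lemma em_primitive_large (nu x t : R) :
  0 < nu <= x -> 0 < t ->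
  Rabs (em_primitive x t - - em_error4_deriv x / 2) <= 4 / (nu ^ 3 * t).
Proof.
  intros Hx Ht.
  assert (HI := RInt_bernoulli_poly3_inv_sq x ltac:(lra)).
  assert (HE : ex_RInt (fun s => bernoulli_poly3 s * / (x + s) ^ 2) 0 1) by (eexists; exact HI).
  assert (HG := ex_RInt_em_primitive x t ltac:(lra)).
  replace (em_primitive x t - - em_error4_deriv x / 2) with
    (1 / 6 * RInt (fun s => minus (bernoulli_poly3 s * gamma_part (x + s) t) (bernoulli_poly3 s * / (x + s) ^ 2)) 0 1).
  - rewrite Rabs_mult, (Rabs_pos_eq (1 / 6)) by lra.
    match goal with |- 1 / 6 * Rabs ?r <= _ => assert (H : Rabs r <= 4 / (nu ^ 3 * t)) end.
    { apply RInt_abs_le_const; [now apply (ex_RInt_minus (V := R_NormedModule))|]; intros s Hs.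
      change (Rabs (bernoulli_poly3 s * gamma_part (x + s) t - bernoulli_poly3 s * / (x + s) ^ 2) <=
        4 / (nu ^ 3 * t)).
      rewrite <- Rmult_minus_distr_l, Rabs_mult.
      rewrite <- (Rmult_1_l (4 / (nu ^ 3 * t))); apply Rmult_le_compat; try apply Rabs_pos;
        [now apply bernoulli_poly3_bound|apply gamma_part_large; lra]. }
    match goal with |- 1 / 6 * Rabs ?r <= _ => generalize (Rabs_pos r) end; lra.
  - rewrite (RInt_minus (V := R_CompleteNormedModule)) by easy.
    rewrite (is_RInt_value _ _ _ _ HI); unfold em_primitive, minus, plus, opp; simpl; field.
Qed.

(** * The kernel and its telescoping integrals *)

(** As [coth (u/2) = 2 / (1 - exp (-u)) - 1], this is [(1 + u^2/12 - (u/2) coth (u/2)) / u^3], the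
    bracket of the integrand at [u = 2 sqrt(beta) tau]. *)
Definition he_kernel (u : R) : R := - (/ (1 - exp (- u)) - 1 / u - 1 / 2 - u / 12) / u ^ 2.

Lemma one_minus_exp_pos (u : R) : 0 < u -> 0 < 1 - exp (- u).
Proof. intros Hu; generalize (exp_increasing (- u) 0 ltac:(lra)); rewrite exp_0; lra. Qed.

Lemma he_kernel_eq (u : R) :
  0 < u -> (1 - exp (- u)) * he_kernel u = 1 / 6 * (u * bernoulli_poly3_laplace u).
Proof.
  intros Hu; assert (H := bernoulli_poly3_laplace_eq u Hu); assert (He := one_minus_exp_pos u Hu).
  unfold he_kernel; set (E := exp (- u)) in *.
  transitivity (- (1 - (1 - E) * (1 / u + 1 / 2 + u / 12)) / u ^ 2); [field; lra|].
  rewrite H; field; lra.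
Qed.

(** By [he_kernel_eq] it suffices that [u <= (1 + u) (1 - exp (-u))], that is
    [(1 + u) exp (-u) <= 1]. This covers the removable singularity at [0] without expanding
    there. *)
Lemma he_kernel_bound (u : R) : 0 < u -> Rabs (he_kernel u) <= 1 + u.
Proof.
  intros Hu; assert (He := one_minus_exp_pos u Hu).
  apply Rmult_le_reg_l with (1 - exp (- u)); [easy|].
  rewrite <- (Rabs_pos_eq (1 - exp (- u))) at 1 by lra.
  rewrite <- Rabs_mult, he_kernel_eq, !Rabs_mult, (Rabs_pos_eq (1 / 6)), (Rabs_pos_eq u) by lra.
  assert (Hb := bernoulli_poly3_laplace_bound u Hu); assert (Hb0 := Rabs_pos (bernoulli_poly3_laplace u)).
  apply Rle_trans with u; [nra|].
  assert (H : (1 + u) * exp (- u) <= 1).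
  { replace 1 with (exp u * exp (- u)) at 2 by (rewrite <- exp_plus, <- exp_0; f_equal; ring).
    apply Rmult_le_compat_r; [left; apply exp_pos|apply exp_ineq1_le]. }
  nra.
Qed.

Lemma ex_RInt_he_kernel (c a b : R) :
  0 < a <= b -> ex_RInt (fun u => exp (- (c * u)) * he_kernel u) a b.
Proof.
  intros Hab; apply ex_RInt_derivable; intros u Hu; rewrite Rmin_left in Hu by lra.
  assert (He := one_minus_exp_pos u ltac:(lra)).
  unfold he_kernel; auto_derive; repeat split; try lra; nra.
Qed.

(** The bound is free of [a] and [b] and tends to zero as [c] grows, so it controls what remains
    after many telescoping steps, where [c = N + nu]. *)
Lemma he_kernel_tail (c a b : R) :
  0 < c -> 0 < a <= 1 -> a <= b ->
  Rabs (RInt (fun u => exp (- (c * u)) * he_kernel u) a b) <= 2 / c + / c ^ 2.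
Proof.
  intros Hc Ha Hab.
  set (H := fun u => - ((1 + u) / c + / c ^ 2) * exp (- (c * u))).
  assert (HI : is_RInt (fun u => exp (- (c * u)) * (1 + u)) a b (H b - H a)).
  { apply (is_RInt_derive (V := R_CompleteNormedModule) H); intros u _.
    - unfold H; auto_derive; [easy|field; lra].
    - apply (ex_derive_continuous (V := R_NormedModule)); auto_derive; easy. }
  apply Rle_trans with (H b - H a).
  - apply (norm_RInt_le (V := R_NormedModule) (fun u => exp (- (c * u)) * he_kernel u)
      (fun u => exp (- (c * u)) * (1 + u)) a b); [easy| | |easy].
    + intros u Hu; change (norm (exp (- (c * u)) * he_kernel u)) with
        (Rabs (exp (- (c * u)) * he_kernel u)).
      rewrite Rabs_mult, (Rabs_pos_eq (exp _)) by (left; apply exp_pos).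
      apply Rmult_le_compat_l; [left; apply exp_pos|apply he_kernel_bound; lra].
    + apply (RInt_correct (V := R_CompleteNormedModule)), ex_RInt_he_kernel; lra.
  - unfold H.
    assert (Hi : 0 < / c) by now apply Rinv_0_lt_compat.
    assert (Hi2 : 0 < / c ^ 2) by now apply Rinv_0_lt_compat, pow_lt.
    assert (Hea : 0 < exp (- (c * a)) <= 1).
    { split; [apply exp_pos|]; rewrite <- exp_0; apply exp_le_compat; nra. }
    assert (Heb := exp_pos (- (c * b))).
    assert (H0 : 0 <= ((1 + b) / c + / c ^ 2) * exp (- (c * b))).
    { apply Rmult_le_pos; [|lra]; apply Rplus_le_le_0_compat; [|lra].
      apply Rmult_le_pos; lra. }
    assert (H1 : (1 + a) / c + / c ^ 2 <= 2 / c + / c ^ 2).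
    { apply Rplus_le_compat_r, Rmult_le_compat_r; lra. }
    assert (H2 : 0 <= (1 + a) / c + / c ^ 2).
    { apply Rplus_le_le_0_compat; [|lra]; apply Rmult_le_pos; lra. }
    set (p := (1 + a) / c + / c ^ 2) in *; set (q := 2 / c + / c ^ 2) in *; nra.
Qed.

(** One step replaces [exp (-x u)] by [exp (-(x+1) u)]. The difference carries the factor
    [(1 - exp (-u)) F u], whose product with [exp (-x u)] is the derivative of [em_primitive x]. *)
Lemma RInt_he_kernel_split (nu a b : R) (N : nat) :
  0 < nu -> 0 < a <= b ->
  RInt (fun u => exp (- (nu * u)) * he_kernel u) a b =
  Rsum (fun n => em_primitive (INR n + nu) b - em_primitive (INR n + nu) a) N
  + RInt (fun u => exp (- ((INR N + nu) * u)) * he_kernel u) a b.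
Proof.
  intros Hnu Hab; induction N as [|N IH]; [simpl; now rewrite !Rplus_0_l|].
  rewrite IH; cbn [Rsum]; rewrite Rplus_assoc; f_equal.
  assert (Hx : 0 < INR N + nu) by (generalize (pos_INR N); lra).
  rewrite S_INR; set (x := INR N + nu) in *; replace (INR N + 1 + nu) with (x + 1) by (unfold x; ring).
  assert (HI : is_RInt (fun u => 1 / 6 * (exp (- (x * u)) * u * bernoulli_poly3_laplace u)) a b
    (em_primitive x b - em_primitive x a)).
  { apply (is_RInt_derive (V := R_CompleteNormedModule) (em_primitive x)); intros u Hu;
      rewrite Rmin_left in Hu by lra.
    - now apply em_primitive_derive.
    (* Continuity of the Laplace transform is read off the elementary form given by
       [he_kernel_eq]. *)
    - apply (continuous_ext_loc (T := R_UniformSpace) (U := R_UniformSpace) _ (fun u => exp (- (x * u)) * ((1 - exp (- u)) * he_kernel u))).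
      + assert (Hu0 : 0 < u) by lra.
        exists (mkposreal u Hu0); intros v Hv.
        assert (0 < v).
        { unfold ball in Hv; simpl in Hv; unfold AbsRing_ball, abs, minus, plus, opp in Hv; simpl in Hv.
          apply Rabs_lt_between in Hv; lra. }
        assert (E : exp (- (x * v)) * ((1 - exp (- v)) * he_kernel v) =
          1 / 6 * (exp (- (x * v)) * v * bernoulli_poly3_laplace v)) by (rewrite he_kernel_eq by easy; ring).
        exact E.
      + assert (He := one_minus_exp_pos u ltac:(lra)).
        apply (ex_derive_continuous (V := R_NormedModule)); unfold he_kernel; auto_derive.
        repeat split; try lra; nra. }
  assert (HX := RInt_correct (V := R_CompleteNormedModule) _ _ _ (ex_RInt_he_kernel (x + 1) a b Hab)).
  assert (HS := is_RInt_plus (V := R_NormedModule) _ _ _ _ _ _ HI HX).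
  apply is_RInt_value in HS; unfold plus at 2 in HS; simpl in HS; rewrite <- HS.
  apply RInt_ext; intros u Hu; rewrite Rmin_left in Hu by lra.
  unfold plus; simpl.
  replace (1 / 6 * (exp (- (x * u)) * u * bernoulli_poly3_laplace u)) with
    (exp (- (x * u)) * (1 / 6 * (u * bernoulli_poly3_laplace u))) by ring.
  rewrite <- he_kernel_eq by lra.
  replace (- ((x + 1) * u)) with (- (x * u) + - u) by ring; rewrite exp_plus; ring.
Qed.

Lemma RInt_he_kernel_estimate (nu a b : R) (N : nat) :
  0 < nu -> 0 < a <= 1 -> 1 <= b ->
  Rabs (RInt (fun u => exp (- (nu * u)) * he_kernel u) a b
    - Rsum (fun n => - em_error4_deriv (INR n + nu) / 2) N) <=
  INR N * (4 / (nu ^ 3 * b) + a ^ 2) + (2 / (INR N + nu) + / (INR N + nu) ^ 2).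
Proof.
  intros Hnu Ha Hb; rewrite (RInt_he_kernel_split nu a b N) by lra.
  assert (HN := pos_INR N).
  assert (Ht := he_kernel_tail (INR N + nu) a b ltac:(lra) Ha ltac:(lra)).
  set (R1 := RInt _ a b) in *.
  assert (Hs : Rabs (Rsum (fun n => em_primitive (INR n + nu) b - em_primitive (INR n + nu) a) N
    - Rsum (fun n => - em_error4_deriv (INR n + nu) / 2) N) <= INR N * (4 / (nu ^ 3 * b) + a ^ 2)).
  { clear R1 Ht HN; induction N as [|N IH].
    - simpl; rewrite Rminus_diag, Rabs_R0; lra.
    - cbn [Rsum]; rewrite S_INR; assert (HN := pos_INR N); set (x := INR N + nu) in *.
      assert (Hx : nu <= x) by (unfold x; lra).
      generalize (em_primitive_small x a ltac:(lra) ltac:(lra))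
        (em_primitive_large nu x b ltac:(lra) ltac:(lra)); intros H1 H2.
      set (A := Rsum (fun n => em_primitive (INR n + nu) b - em_primitive (INR n + nu) a) N) in *.
      set (B := Rsum (fun n => - em_error4_deriv (INR n + nu) / 2) N) in *.
      replace (A + (em_primitive x b - em_primitive x a) - (B + - em_error4_deriv x / 2)) with
        ((A - B) + ((em_primitive x b - - em_error4_deriv x / 2) + - em_primitive x a)) by field.
      eapply Rle_trans; [apply Rabs_triang|].
      eapply Rle_trans; [apply Rplus_le_compat_l, Rabs_triang|]; rewrite Rabs_Ropp; lra. }
  replace (Rsum (fun n => em_primitive (INR n + nu) b - em_primitive (INR n + nu) a) N + R1
    - Rsum (fun n => - em_error4_deriv (INR n + nu) / 2) N) with
    ((Rsum (fun n => em_primitive (INR n + nu) b - em_primitive (INR n + nu) a) N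
    - Rsum (fun n => - em_error4_deriv (INR n + nu) / 2) N) + R1) by ring.
  eapply Rle_trans; [apply Rabs_triang|]; lra.
Qed.

(** * The Heisenberg-Euler integral *)

Lemma RInt_he_kernel_limit (nu s eta : R) :
  0 < nu -> is_lim_seq (Rsum (fun n => em_error4_deriv (INR n + nu))) s -> 0 < eta ->
  exists a0 b0 : R, 0 < a0 <= 1 /\ 1 <= b0 /\ forall a b : R, 0 < a <= a0 -> b0 <= b ->
    Rabs (RInt (fun u => exp (- (nu * u)) * he_kernel u) a b - - s / 2) < eta.
Proof.
  intros Hnu Hs Heta.
  apply is_lim_seq_spec in Hs.
  assert (He3 : 0 < eta / 3) by lra.
  destruct (Hs (mkposreal _ He3)) as [N1 HN1]; simpl in HN1.
  (* For [c > 1] and [c > 9 / eta] the tail [2 / c + 1 / c^2] is below [3 / c < eta / 3]. *)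
  assert (HX : 0 <= Rmax 1 (9 / eta)) by (apply Rle_trans with 1; [lra|apply Rmax_l]).
  destruct (nfloor_ex _ HX) as [N2 [_ HN2]].
  set (N := (N1 + S N2)%nat); specialize (HN1 N ltac:(unfold N; lia)).
  set (c := INR N + nu).
  assert (HN0 := pos_INR N).
  assert (Hc : Rmax 1 (9 / eta) < c).
  { unfold c, N; rewrite plus_INR, S_INR; generalize (pos_INR N1); lra. }
  assert (Hc1 : 1 < c) by (apply Rle_lt_trans with (2 := Hc), Rmax_l).
  assert (Hc2 : 9 / eta < c) by (apply Rle_lt_trans with (2 := Hc), Rmax_r).
  assert (Hi : 0 < / c <= 1).
  { split; [apply Rinv_0_lt_compat; lra|].
    rewrite <- Rinv_1; apply Rinv_le_contravar; lra. }
  assert (Hi2 : / c < eta / 9).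
  { replace (eta / 9) with (/ (9 / eta)) by (field; lra).
    apply Rinv_lt_contravar; [|easy]; apply Rmult_lt_0_compat; [apply Rdiv_lt_0_compat|]; lra. }
  assert (Htail : 2 / c + / c ^ 2 < eta / 3).
  { replace (2 / c + / c ^ 2) with (2 * / c + / c * / c) by (field; lra).
    assert (/ c * / c <= 1 * / c) by (apply Rmult_le_compat_r; lra); lra. }
  assert (Hn3 : 0 < nu ^ 3) by now apply pow_lt.
  (* With [N] fixed and [a^2 <= a], these thresholds make each of the two [N]-fold errors at most
     [eta / 6]; adding the tail and half of [|S - s|] stays below [eta]. *)
  exists (Rmin 1 (eta / (6 * (INR N + 1)))), (Rmax 1 (24 * (INR N + 1) / (nu ^ 3 * eta))).
  split; [split; [apply Rmin_pos; [lra|apply Rdiv_lt_0_compat; lra]|apply Rmin_l]|].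
  split; [apply Rmax_l|]; intros a b Ha Hb.
  assert (Ha1 := Rle_trans _ _ _ (proj2 Ha) (Rmin_l _ _)).
  assert (Ha2 := Rle_trans _ _ _ (proj2 Ha) (Rmin_r _ _)).
  assert (Hb1 := Rle_trans _ _ _ (Rmax_l _ _) Hb).
  assert (Hb2 := Rle_trans _ _ _ (Rmax_r _ _) Hb).
  assert (HE := RInt_he_kernel_estimate nu a b N Hnu ltac:(lra) Hb1); fold c in HE.
  assert (HA : INR N * a ^ 2 <= eta / 6).
  { apply Rle_trans with ((INR N + 1) * a).
    { assert (a ^ 2 <= a) by (simpl; nra); apply Rmult_le_compat; try lra; apply pow2_ge_0. }
    apply (Rmult_le_compat_l (INR N + 1)) in Ha2; [|lra].
    now replace ((INR N + 1) * (eta / (6 * (INR N + 1)))) with (eta / 6) in Ha2 by (field; lra). }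
  assert (HB : INR N * (4 / (nu ^ 3 * b)) <= eta / 6).
  { apply Rmult_le_reg_r with (nu ^ 3 * b); [apply Rmult_lt_0_compat; lra|].
    replace (INR N * (4 / (nu ^ 3 * b)) * (nu ^ 3 * b)) with (4 * INR N) by (field; split; lra).
    apply (Rmult_le_compat_l (nu ^ 3 * eta / 6)) in Hb2.
    - replace (nu ^ 3 * eta / 6 * (24 * (INR N + 1) / (nu ^ 3 * eta))) with (4 * (INR N + 1)) in Hb2
        by (field; split; lra); lra.
    - apply Rmult_le_pos; [|lra]; apply Rmult_le_pos; lra. }
  assert (Hsum : Rsum (fun n => - em_error4_deriv (INR n + nu) / 2) N =
    - / 2 * Rsum (fun n => em_error4_deriv (INR n + nu)) N).
  { rewrite <- Rsum_scal; apply Rsum_ext; intros; field. }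
  rewrite Hsum in HE.
  set (S := Rsum (fun n => em_error4_deriv (INR n + nu)) N) in *.
  set (I := RInt _ a b) in *.
  replace (I - - s / 2) with ((I - - / 2 * S) + - / 2 * (S - s)) by field.
  eapply Rle_lt_trans; [apply Rabs_triang|].
  rewrite (Rabs_mult (- / 2)), (Rabs_left (- / 2)) by lra.
  generalize (Rabs_pos (S - s)); lra.
Qed.

Lemma integrand_rescaled (beta tau : R) :
  0 < beta -> 0 < tau ->
  exp (- tau) / tau ^ 3 *
    (1 + beta * tau ^ 2 / 3 - sqrt beta * tau * coth (sqrt beta * tau)) =
  4 * beta * (2 * sqrt beta * (exp (- (1 / (2 * sqrt beta) * (2 * sqrt beta * tau)))
    * he_kernel (2 * sqrt beta * tau))).
Proof.
  intros Hb Ht; set (q := sqrt beta).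
  assert (Hq : 0 < q) by now apply sqrt_lt_R0.
  replace beta with (q * q) by (now apply sqrt_sqrt, Rlt_le).
  replace (1 / (2 * q) * (2 * q * tau)) with tau by (field; lra).
  assert (Hqt : 0 < q * tau) by now apply Rmult_lt_0_compat.
  set (E := exp (q * tau)).
  assert (HE : 1 < E) by (unfold E; rewrite <- exp_0; now apply exp_increasing).
  assert (HE2 : exp (- (2 * q * tau)) = / (E * E)).
  { unfold E; rewrite <- exp_plus, <- exp_Ropp; f_equal; ring. }
  unfold coth, cosh, sinh, he_kernel; rewrite HE2, (exp_Ropp (q * tau)); fold E.
  field; repeat split; try lra; nra.
Qed.

Lemma is_RInt_gen_integrand (beta s : R) :
  0 < beta ->
  is_lim_seq (Rsum (fun n => em_error4_deriv (INR n + 1 / (2 * sqrt beta)))) s ->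
  is_RInt_gen
    (fun tau : R =>
       exp (- tau) / tau ^ 3 *
       (1 + beta * tau ^ 2 / 3
        - sqrt beta * tau * coth (sqrt beta * tau)))
    (at_right 0) (Rbar_locally p_infty) (4 * beta * (- s / 2)).
Proof.
  intros Hb Hs.
  assert (Hq : 0 < sqrt beta) by now apply sqrt_lt_R0.
  set (q := sqrt beta) in *; set (nu := 1 / (2 * q)) in *.
  assert (Hnu : 0 < nu) by (apply Rdiv_lt_0_compat; lra).
  intros P [eps HP].
  destruct (RInt_he_kernel_limit nu s (eps / (4 * beta)) Hnu Hs) as (a0 & b0 & Ha0 & Hb0 & Hlim).
  { apply Rdiv_lt_0_compat; [apply cond_pos|lra]. }
  assert (Hpa : 0 < a0 * nu) by (apply Rmult_lt_0_compat; lra).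
  (* Since [u = 2 q tau = tau / nu], the thresholds [a0] and [b0] for [u] become [a0 * nu] and
     [b0 * nu] for [tau]. *)
  apply (Filter_prod _ _ _ (fun a => 0 < a < a0 * nu) (fun b => b0 * nu < b)).
  - exists (mkposreal _ Hpa); intros y Hy Hy0; split; [exact Hy0|].
    unfold ball in Hy; simpl in Hy; unfold AbsRing_ball, abs, minus, plus, opp in Hy; simpl in Hy.
    apply Rabs_lt_between in Hy; lra.
  - exists (b0 * nu); intros y Hy; exact Hy.
  - intros A B HA HB; simpl.
    set (G := fun u => exp (- (nu * u)) * he_kernel u) in *.
    assert (Hqnu : 2 * q * nu = 1) by (unfold nu; field; lra).
    assert (HA' : 0 < 2 * q * A <= a0).
    { split; [apply Rmult_lt_0_compat; lra|].
      replace a0 with (2 * q * (a0 * nu)) by (rewrite <- (Rmult_1_r a0) at 2; rewrite <- Hqnu; ring).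
      apply Rmult_le_compat_l; lra. }
    assert (HB' : b0 <= 2 * q * B).
    { replace b0 with (2 * q * (b0 * nu)) by (rewrite <- (Rmult_1_r b0) at 2; rewrite <- Hqnu; ring).
      apply Rmult_le_compat_l; lra. }
    assert (HAB : A <= B) by (apply Rmult_le_reg_l with (2 * q); lra).
    specialize (Hlim _ _ HA' HB').
    assert (HI : is_RInt G (2 * q * A) (2 * q * B) (RInt G (2 * q * A) (2 * q * B))).
    { apply (RInt_correct (V := R_CompleteNormedModule)), ex_RInt_he_kernel; lra. }
    set (I := RInt G _ _) in *.
    exists (4 * beta * I); split.
    + assert (HJ := is_RInt_scal (V := R_NormedModule) _ _ _ (4 * beta) _
        (is_RInt_comp_lin (V := R_NormedModule) G (2 * q) 0 A B I
          ltac:(rewrite !Rplus_0_r; exact HI))).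
      revert HJ; apply (is_RInt_ext (V := R_NormedModule)); intros tau Htau.
      rewrite Rmin_left in Htau by easy.
      unfold scal; simpl; unfold mult; simpl; rewrite Rplus_0_r.
      symmetry; apply (integrand_rescaled beta tau); lra.
    + apply HP; unfold ball; simpl; unfold AbsRing_ball, abs, minus, plus, opp; simpl.
      replace (4 * beta * I + - (4 * beta * (- s / 2))) with (4 * beta * (I - - s / 2)) by ring.
      rewrite Rabs_mult, Rabs_pos_eq by lra.
      apply (Rmult_lt_compat_l (4 * beta)) in Hlim; [|lra].
      now replace (4 * beta * (eps / (4 * beta))) with (pos eps) in Hlim by (field; lra).
Qed.

Theorem mainTheorem3 (beta : R) (hbeta : 0 < beta) :
  exists (I : R) (zeta' : C),
    is_RInt_gen
      (fun tau : R =>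
         exp (- tau) / tau ^ 3 *
         (1 + beta * tau ^ 2 / 3
          - sqrt beta * tau * coth (sqrt beta * tau)))
      (at_right 0) (Rbar_locally p_infty) I /\
    is_hurwitz_zeta_deriv (RtoC (-1)) (1 / (2 * sqrt beta)) zeta' /\
    RtoC I =
      (RtoC (4 * beta) * zeta'
       + RtoC (1 / 4 - beta / 3
               - beta * (ln 16 + 2 * ln beta)
                 * (- (1 / 12) + 1 / (4 * sqrt beta) - 1 / (8 * beta))))%C.
Proof.
  assert (Hq : 0 < sqrt beta) by now apply sqrt_lt_R0.
  assert (Hnu : 0 < 1 / (2 * sqrt beta)) by (apply Rdiv_lt_0_compat; lra).
  destruct (hurwitz_zeta_deriv_m1 _ Hnu) as (s & Hs & Hd).
  exists (4 * beta * (- s / 2)); eexists; split; [|split; [exact Hd|]].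
  - now apply is_RInt_gen_integrand.
  (* The unknown sum enters both sides as [- 2 beta s]. In the rest,
     [ln 16 + 2 ln beta = - 4 ln nu], [beta nu^2 = 1/4], and the last bracket of the statement is
     [- B_2(nu) / 2], the value of zeta at [-1]. *)
  - rewrite <- RtoC_mult, <- RtoC_plus; f_equal.
    assert (Hln16 : ln 16 = 4 * ln 2).
    { replace 16 with (2 ^ 4) by ring; rewrite ln_pow by lra; simpl; ring. }
    assert (Hlnb : ln beta = 2 * ln (sqrt beta)).
    { rewrite <- (sqrt_sqrt beta) at 1 by lra; rewrite ln_mult by easy; ring. }
    assert (Hlnnu : ln (1 / (2 * sqrt beta)) = - ln 2 - ln (sqrt beta)).
    { unfold Rdiv; rewrite Rmult_1_l, ln_Rinv, ln_mult by lra; ring. }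
    unfold em_sum4_deriv; rewrite Hln16, Hlnb, Hlnnu.
    set (q := sqrt beta) in *; replace beta with (q * q) by (apply sqrt_sqrt; lra).
    field; lra.
Qed.
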